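(* Consider the inhomogeneous multi-species TASEP on $\mathbb{Z}$ with jump rates $(\lambda_x)_{x\in\mathbb{Z}}$ and drift to the left, started from any initial condition $(\eta_x(0))_{x\in\mathbb{Z}}$, and let $t\ge 0$. Fix $k$ lattice points $x_1<\dots<x_k$ in $\mathbb{Z}$ and $k$ species numbers $m_1<\dots<m_k$ in $\mathbb{Z}$, and let $$\mu_i=\inf\{x\in\mathbb{Z} : \eta_x(0)\ge m_i\},\qquad 1\le i\le k,$$ where $\inf\varnothing=+\infty$ by convention (and $\mu_i=-\infty$ if the set is unbounded below). Then $$\mathbb{P}\big(g_{x_1}(t)\ge m_1,\dots,g_{x_k}(t)\ge m_k\big)=\det[G_{ij}]_{1\le i,j\le k},$$ where $G$ is the $k\times k$ matrix with entries $$G_{ij}=\mathbb{P}\big(\xi_{\mu_i}(t)<x_j\big)-1_{\{i<j\}}.$$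
   Context: Multi-species TASEP (totally asymmetric simple exclusion process): a continuous-time Markov process of particle configurations $\eta(t)=(\eta_x(t))_{x\in\mathbb{Z}}$ on $\mathbb{Z}$, where $\eta_x(t)\in\mathbb{Z}\cup\{-\infty\}$ is the species number of the particle at site $x$ at time $t$, with $\eta_x(t)=-\infty$ meaning that site $x$ is empty (a hole). Each site has at most one particle. The particle at site $x$ attempts to jump one step to the left (to $x-1$) at exponential rate $\lambda_x>0$, and all jump attempts occur independently of each other. Particles with higher species have priority: if a particle of species $j$ attempts to jump to a site occupied by species $i$ (where $i=-\infty$ for a hole), then the two switch places if $i<j$, and the jump is blocked if $i>j$ (if $i=j$, the configuration is unchanged either way). Height function: $g_y(t)=\max\{\eta_x(t) : x<y\}$, the maximum species number among all particles strictly to the left of $y$ at time $t$; thus $g_y(t)\ge m$ means that some site $x<y$ has $\eta_x(t)\ge m$. Single walker: for $\mu\in\mathbb{Z}\cup\{\pm\infty\}$, $\xi_\mu(t)$ denotes the location at time $t$ of a single random walker which starts at $\mu$ at time $0$ and, when at site $x$, jumps one step to the left with exponential rate $\lambda_x$. If $\mu=\pm\infty$, then $\xi_\mu(t)=\mu$ for all $t\ge 0$. *)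

(* Defs.v *)
From HB Require Import structures.
From mathcomp Require Import all_boot all_order all_algebra.
From mathcomp Require Import all_classical all_reals all_analysis.

Set Implicit Arguments.
Unset Strict Implicit.
Unset Printing Implicit Defensive.

Import Order.TTheory GRing.Theory Num.Theory.
Import numFieldNormedType.Exports.

Local Open Scope classical_set_scope.
Local Open Scope ring_scope.

Definition mutually_independent {R : realType} {d : measure_display}
    {T : measurableType d} (P : probability T R) {d' : measure_display}
    {U : measurableType d'} {I : eqType} (X : I -> T -> U) : Prop :=
  forall (s : seq I) (B : I -> set U), uniq s -> (forall i, measurable (B i)) ->
    P (\bigcap_(i in [set` s]) (X i @^-1` B i)) =
    (\prod_(i <- s) P (X i @^-1` B i))%E.

(* [N x] counts the rings of the clock of site [x].  Applying
   [mutually_independent] to the increments indexed by (site, time slot) gives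
   both the independence of the clocks of different sites and the independence
   of the increments of each clock.  The subtraction of [nat] is truncated, but
   the counts are almost surely nondecreasing. *)
Definition poisson_clocks {R : realType} {d : measure_display}
    {T : measurableType d} (P : probability T R) (lambda : int -> R)
    (N : int -> R -> T -> nat) : Prop :=
  [/\ (forall x t, 0 <= t -> measurable_fun [set: T] (N x t)),
      {ae P, forall w, forall x,
        [/\ N x 0 w = 0%N,
            (forall s t, 0 <= s <= t -> (N x s w <= N x t w)%N)
          & forall t, 0 <= t -> \forall s \near t^'+, N x s w = N x t w]},
      (forall x s t n, 0 <= s < t ->
        P [set w | (N x t w - N x s w)%N = n] =
        (poisson_pmf (lambda x * (t - s)) n)%:E)
    & forall r : nat -> R, 0 <= r 0%N -> (forall n, r n <= r n.+1) ->
        mutually_independent P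
          (fun p : int * nat => fun w => (N p.1 (r p.2.+1) w - N p.1 (r p.2) w)%N)].

Definition rings {R : realType} (c : R -> nat) (t : R) : Prop :=
  0 < t /\ forall s, 0 <= s < t -> (c s < c t)%N.

(* Species live in Z with a hole [-oo] added; [+oo] is not a species. *)
Definition config := int -> \bar int.

Definition attempt (x : int) (c : config) : config :=
  fun y => if (c (x - 1)%R < c x)%E then
             if y == x - 1 then c x else if y == x then c (x - 1) else c y
           else c y.

(* The sample path [eta] starts from [eta0] and evolves by the jump attempts at
   the rings of the clocks of the sites in [A].  A condition on [\forall s \near
   t^'-] expresses a left limit, since the values are discrete. *)
Definition tasep_path {R : realType} (A : set int) (N : int -> R -> nat)
    (eta0 : config) (eta : R -> config) : Prop :=
  let ringing x t := A x /\ rings (N x) t in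
  [/\ eta 0 =1 eta0,
      (forall t x, 0 <= t -> \forall s \near t^'+, eta s x = eta t x),
      (forall t x, 0 < t -> ringing x t ->
        \forall s \near t^'-, eta t (x - 1) = attempt x (eta s) (x - 1) /\
                              eta t x = attempt x (eta s) x)
    & (forall t x, 0 < t -> ~ ringing x t -> ~ ringing (x + 1) t ->
        \forall s \near t^'-, eta t x = eta s x)].

(* Besides obeying the jump rule at all sites, the process is the limit of the
   finite systems in which only the clocks of [-n, n] are active.  When the
   graphical construction is locally finite (e.g. for bounded rates) this is
   automatic; for rates such that the sum of the 1 / lambda x over x > 0
   converges, it discards the spurious solutions of the jump rule in which
   particles enter from +oo. *)
Definition tasep_sample {R : realType} (N : int -> R -> nat)
    (eta0 : config) (eta : R -> config) : Prop :=
  tasep_path [set: int] N eta0 eta /\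
  exists etan : nat -> R -> config,
    (forall n, tasep_path [set x : int | `|x| <= n%:Z] N eta0 (etan n)) /\
    (forall t x, 0 <= t -> \forall n \near \oo, etan n t x = eta t x).

Definition is_tasep {R : realType} {d : measure_display}
    {T : measurableType d} (P : probability T R) (lambda : int -> R)
    (eta0 : config) (eta : R -> T -> config) : Prop :=
  (forall t x v, 0 <= t -> measurable [set w | eta t w x = v]) /\
  exists N : int -> R -> T -> nat,
    poisson_clocks P lambda N /\
    {ae P, forall w, tasep_sample (fun x s => N x s w) eta0 (eta ^~ w)}.

(* A supremum in [\bar int]: it is the maximum when there is one, and [+oo] when
   the species to the left of [y] are unbounded above. *)
Definition height (c : config) (y : int) : \bar int :=
  supremum -oo%E [set c x | x in [set x | x < y]].

(* [infimum] takes the default value [+oo] on the empty set, and is [-oo] on a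
   nonempty set that is unbounded below. *)
Definition leftmost (c : config) (m : int) : \bar int :=
  infimum +oo%E [set x%:E | x in [set x | (m%:E <= c x)%E]].

Definition walk_path {R : realType} (N : int -> R -> nat) (x0 : int)
    (xi : R -> int) : Prop :=
  [/\ xi 0 = x0,
      (forall t, 0 <= t -> \forall s \near t^'+, xi s = xi t)
    & forall t, 0 < t -> \forall s \near t^'-,
        (rings (N (xi s)) t -> xi t = xi s - 1) /\
        (~ rings (N (xi s)) t -> xi t = xi s)].

Definition is_walker {R : realType} {d : measure_display}
    {T : measurableType d} (P : probability T R) (lambda : int -> R)
    (x0 : int) (xi : R -> T -> int) : Prop :=
  (forall t v, 0 <= t -> measurable [set w | xi t w = v]) /\
  exists N : int -> R -> T -> nat,
    poisson_clocks P lambda N /\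
    {ae P, forall w, walk_path (fun x s => N x s w) x0 (xi ^~ w)}.

(* The walkers started at -oo and +oo do not move. *)
Definition walker_at {R : realType} {T : Type} (xi : int -> R -> T -> int)
    (mu : \bar int) (t : R) (w : T) : \bar int :=
  if mu is x%:E then (xi x t w)%:E else mu.

(* Main.v *)
Require Import Defs.
From HB Require Import structures.
From mathcomp Require Import all_boot all_order all_algebra.
From mathcomp Require Import all_classical all_reals all_analysis.
From mathcomp Require Import perm zify ring lra.

Import Order.TTheory GRing.Theory Num.Theory.
Import numFieldNormedType.Exports.

(** Call the site of the leftmost particle of species at least [m] the front of
    [m].  All particles to its left have species below [m], so nothing blocks
    this particle; if a particle of higher species overtakes it, that one becomes
    the leftmost and the front does not move.  So the front sits at [z] until the
    clock of [z] rings, and then goes to [z - 1].  The fronts of [m_1 < ... < m_k] are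
    therefore coalescing walks started at [mu_1 <= ... <= mu_k] and driven by
    the same clocks, and [g_y(t) >= m] says that the front of [m] is left of [y]
    at time [t].  It remains to compute the probability that coalescing walks
    end below [x_1 < ... < x_k].

    The determinant ([mean_det]) comes from conditioning on the first ring.
    The rows of [G] that belong to walks at a common site differ by constant
    rows, since only the term [1_{i<j}] then distinguishes them.  Subtracting
    one of these rows from the others leaves a single row that depends on
    whether the clock of that site rings, and the determinant is affine in a
    single row, so averaging over the ring passes inside it.  When no time is
    left, [det_threshold] identifies the determinant with the indicator of the
    event.

    This recursion needs finitely many rings in a known order.  Time is cut into
    [M] slots, only the clocks of [-n, n] are read, and the pairs (site, slot)
    are processed one after the other, each acting if its clock rings in its
    slot.  As long as no slot contains two rings of these clocks, the resulting
    run is exactly the finite system of clocks in [-n, n] ([tasep_run]), and a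
    walker is followed exactly until it leaves [-n, n] ([walk_run]).  For fixed
    [n] two rings in one slot have probability [O(1/M)] ([crowded_le]), so a
    suitable [M] depending on [n] makes the runs converge, both for the particle
    system and for the walkers ([hit_cvg]).

    The process is only a sitewise limit of the finite systems, whereas a height
    looks at infinitely many sites, and a front could escape to minus infinity.
    Therefore heights are first restricted to the sites from [-L] on.  In the
    finite systems this loses at most the probability that certain walkers,
    tagging particles of species at least [m_i], are below [-L] at time [t]
    ([sights_bounds]).  The bound survives the limit in [n], and it vanishes as
    [L] grows because every walker is at a finite site at time [t]. *)

Set Implicit Arguments.
Unset Strict Implicit.
Unset Printing Implicit Defensive.

Local Open Scope classical_set_scope.
Local Open Scope ring_scope.

(** * Processing a schedule of attempts *)

Section runs.
Context {I : Type}.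

Fixpoint run {S : Type} (act : I -> S -> S) (b : I -> bool) (l : seq I) (s : S)
    : S :=
  if l is p :: l' then run act b l' (if b p then act p s else s) else s.

Lemma run_cat {S : Type} (act : I -> S -> S) (b : I -> bool) (l1 l2 : seq I) s :
  run act b (l1 ++ l2) s = run act b l2 (run act b l1 s).
Proof. by elim: l1 s => //= p l1 IH s. Qed.

Lemma run_inv {S : Type} (Q : S -> Prop) (act : I -> S -> S) (b : I -> bool)
    (l : seq I) s :
  (forall p s, Q s -> Q (act p s)) -> Q s -> Q (run act b l s).
Proof.
move=> H; elim: l s => //= p l IH s Qs; apply: IH; case: ifP => // _.
exact: H.
Qed.

Lemma run_rel {S S' : Type} (Q : S -> S' -> Prop) (act : I -> S -> S)
    (act' : I -> S' -> S') (b : I -> bool) (l : seq I) s s' :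
  (forall p s s', Q s s' -> Q (act p s) (act' p s')) ->
  Q s s' -> Q (run act b l s) (run act' b l s').
Proof.
move=> H; elim: l s s' => //= p l IH s s' Qs; apply: IH; case: ifP => // _.
exact: H.
Qed.

End runs.

(** Used inside one slot, where at most one clock of the window rings: the order
    in which the sites of the slot are processed is then irrelevant. *)
Lemma run_single {I : eqType} {S : Type} (act : I -> S -> S) (b : I -> bool)
    (l : seq I) (p : I) (s : S) : uniq l ->
  (forall q, q \in l -> b q -> q = p) ->
  run act b l s = if (p \in l) && b p then act p s else s.
Proof.
elim: l s => //= q l IH s /andP[ql ul] H.
have bl : forall r, r \in l -> b r -> r = p.
  by move=> r rl; apply: H; rewrite inE rl orbT.
rewrite IH// inE; have [pq|pq] /= := eqVneq p q.
  by subst q; rewrite (negbTE ql) /=.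
have -> // : b q = false.
by apply: contra_neqF pq => bq; rewrite (H q (mem_head _ _) bq).
Qed.

(** * Fronts *)

(** The end points of the extended line are fixed, as for the walkers started
    there. *)
Definition move (z : int) (mu : \bar int) : \bar int :=
  if mu == z%:E then (z - 1)%:E else mu.

Lemma move_homo (z : int) : {homo move z : mu nu / (mu <= nu)%E}.
Proof.
move=> mu nu; rewrite /move; case: (eqVneq mu z%:E) => [->|muz].
  case: (eqVneq nu z%:E) => // nuz zn; apply: le_trans zn.
  by rewrite lee_fin; lia.
case: (eqVneq nu z%:E) => [->|//].
case: mu muz => //= [y|]; rewrite ?leNye// !lee_fin => yz yl.
have : y != z by apply: contra yz => /eqP ->.
lia.
Qed.

(** [mu] is the front of [m], described by the half-lines that meet the particles
    of species at least [m]; this covers at once a front at a site, at [+oo] (no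
    such particle) and at [-oo] (such particles arbitrarily far to the left). *)
Definition front (c : config) (m : int) (mu : \bar int) : Prop :=
  forall x : int, (mu < x%:E)%E <-> exists2 y, y < x & (m%:E <= c y)%E.

Lemma front_fin {c m} {y : int} : front c m y%:E ->
  (m%:E <= c y)%E /\ forall x, x < y -> (c x < m%:E)%E.
Proof.
move=> H; have below x : x < y -> (c x < m%:E)%E.
  move=> xy; rewrite ltNge; apply/negP => mx.
  have : (y%:E < y%:E)%E by apply/H; exists x.
  by rewrite ltxx.
split => //; have /H[x xy mx] : (y%:E < (y + 1)%R%:E)%E by rewrite lte_fin; lia.
have [xy'|xy'] := ltP x y; last by have -> : y = x by lia.
by move: mx; rewrite leNgt below.
Qed.

(** If the front is at [z], the attempt at [z] succeeds, since the site [z - 1]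
    carries a lower species.  An attempt at any other site
    moves species at least [m] only among sites that are not to the left of the
    front, and leaves one at the front. *)
Lemma attempt_front z c m mu : front c m mu -> front (attempt z c) m (move z mu).
Proof.
move=> H x; rewrite /move; case: (eqVneq mu z%:E) => [muz|muz].
  subst mu; have [mz below] := front_fin H.
  have cz : (c (z - 1)%R < c z)%E.
    by apply: lt_le_trans mz; apply: below; lia.
  rewrite lte_fin; split=> [xz|[y yx]].
    by exists (z - 1) => //; rewrite /attempt cz eqxx.
  rewrite /attempt cz; case: eqP => [<-//|yz1].
  case: eqP => [yz|yz my].
    move=> mz1; suff : (c (z - 1)%R < m%:E)%E by rewrite ltNge mz1.
    by apply: below; lia.
  rewrite ltNge; apply/negP => xz.
  suff : (c y < m%:E)%E by rewrite ltNge my.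
  by apply: below; lia.
rewrite H /attempt; case: (boolP (c (z - 1)%R < c z)%E) => // cz.
split => -[y yx my].
  case: (eqVneq y z) => [yz|yz]; last first.
    exists y => //; case: eqP => [yz1|yz1]; last by rewrite (negbTE yz).
    by apply: le_trans (ltW cz); rewrite -yz1.
  exists (z - 1); first by lia.
  by rewrite eqxx -yz.
move: my; case: eqP => [yz1 mz|yz1].
  have [mz1|mz1] := leP m%:E (c (z - 1)%R); first by exists (z - 1) => //; lia.
  have [xz|zx] := ltP z x; first by exists z.
  have {zx}xz : x = z by lia.
  have : (mu < (z + 1)%R%:E)%E by apply/H; exists z => //; lia.
  case: mu H muz => [u|//|] H muz; last first.
    by move=> _; apply/H; rewrite ltNyr.
  rewrite lte_fin => uz; apply/H; rewrite lte_fin xz.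
  suff : u != z by lia.
  by apply: contra muz => /eqP ->.
case: eqP => [yz my|yz my]; last by exists y.
by exists (z - 1) => //; lia.
Qed.

(** A walker started on a particle of species at least [m] always sits on such a
    particle: if the attempt of the particle is blocked, then by one of at least
    the same species, and if the particle is overtaken, then by one of higher
    species.  Unlike the front, this walker is at a finite site even
    when the front is [-oo]. *)
Lemma attempt_track z c m mu :
  (exists2 y, mu = y%:E & (m%:E <= c y)%E) ->
  exists2 y, move z mu = y%:E & (m%:E <= attempt z c y)%E.
Proof.
move=> [y -> my]; rewrite /move /attempt.
case: (eqVneq y%:E z%:E) => [[yz]|/eqP yz].
  exists (z - 1) => //; subst y; case: ifPn => [_|]; first by rewrite eqxx.
  by rewrite -leNgt; apply: le_trans.
exists y => //; case: ifPn => // cz; case: eqP => [yz1|yz1].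
  by apply: le_trans (ltW cz); rewrite -yz1.
by case: eqP => // yz2; case: yz; rewrite yz2.
Qed.

Lemma move_le z mu : (move z mu <= mu)%E.
Proof. by rewrite /move; case: eqP => [->|//]; rewrite lee_fin; lia. Qed.

Lemma int_set_min (A : set int) : A !=set0 -> has_lbound A ->
  exists2 u, A u & forall v, A v -> u <= v.
Proof.
move=> [a Aa] [b Ab].
have exP : exists k : nat, `[< A (b + k%:Z) >].
  exists `|a - b|%N; apply/asboolP; have := Ab _ Aa => ba.
  by have -> : b + `|a - b|%N = a by lia.
case: (ex_minnP exP) => k /asboolP Ak kmin.
exists (b + k%:Z) => // v Av; have bv := Ab _ Av.
have := kmin `|v - b|%N; rewrite asboolT; last first.
  by have -> : b + `|v - b|%N = v by lia.
by move=> /(_ isT); lia.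
Qed.

(** The extended integers form a complete lattice, hence the default values of
    [supremum] and [infimum] are only taken on the empty set. *)
Lemma supremums_ereal_int (A : set (\bar int)) : supremums A !=set0.
Proof.
pose S := [set u : int | ubound A u%:E].
have [S0|S0] := pselect (S !=set0); last first.
  exists +oo%E; split => [a _|b Ab]; first exact: leey.
  case: b Ab => //= [b|] Ab; case: S0; first by exists b.
  by exists 0 => a Aa; apply: le_trans (Ab _ Aa) _; exact: leNye.
have [Slb|Slb] := pselect (has_lbound S).
  have [u Su umin] := int_set_min S0 Slb.
  exists u%:E; split => // -[b| |] Ab; rewrite ?leey//.
    by rewrite lee_fin; exact: umin.
  case: Slb => l Sl; suff : S (l - 1) by move/Sl; lia.
  by move=> a Aa; apply: le_trans (Ab _ Aa) _; exact: leNye.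
exists -oo%E; split=> [a Aa|b _]; last exact: leNye.
case: a Aa => [a| |] Aa //; last by case: S0 => u /(_ _ Aa).
exfalso; apply: Slb; exists a => u /(_ _ Aa); by rewrite lee_fin.
Qed.

Lemma infimums_ereal_int (A : set (\bar int)) : infimums A !=set0.
Proof.
have [s [sub slb]] := supremums_ereal_int (lbound A).
exists s; split => // a Aa; apply: slb => b; exact.
Qed.

Lemma leftmost_front c m : front c m (leftmost c m).
Proof.
rewrite /leftmost => x; set A := [set _ | _ in _].
have Ai := infimums_ereal_int A; split.
  rewrite /infimum; case: ifPn => // /set0P _.
  case: xgetP => [s _ [_ sub]|]; last by case: Ai => s As /(_ s).
  move=> sx; apply: contrapT => H.
  suff : (x%:E <= s)%E by rewrite leNgt sx.
  apply: sub => _ [y my <-]; rewrite lee_fin leNgt; apply/negP => yx.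
  by apply: H; exists y.
move=> [y yx my]; apply: (@le_lt_trans _ _ y%:E); last by rewrite lte_fin.
by apply: le_infimum_Nmem => //; exists y.
Qed.

Lemma height_geP c (m x : int) :
  (m%:E <= height c x)%E <-> exists2 y, y < x & (m%:E <= c y)%E.
Proof.
rewrite /height; set A := [set _ | _ in _].
have Ai := supremums_ereal_int A; split => [mh|[y yx my]]; last first.
  by apply: le_trans my _; apply: ge_supremum_Nmem => //; exists y.
apply: contrapT => H; move: mh; rewrite leNgt => /negP; apply.
apply: (@le_lt_trans _ _ (m - 1)%R%:E); last by rewrite lte_fin; lia.
rewrite /supremum; case: ifPn => _; first exact: leNye.
case: xgetP => [s _ [_ sub]|]; last by case: Ai => s As /(_ s).
apply: sub => _ [y yx <-].
have : (c y < m%:E)%E by rewrite ltNge; apply/negP => my; apply: H; exists y.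
by case: (c y) => [u| |] //; rewrite ?leNye// lte_fin lee_fin; lia.
Qed.

Lemma leftmost_homo c : {homo leftmost c : m m' / (m <= m')%R >-> (m <= m')%E}.
Proof.
move=> m m' mm'; have H := leftmost_front c m; have H' := leftmost_front c m'.
case E' : (leftmost c m') => [u| |]; rewrite ?leey//.
  move: H'; rewrite E' => /front_fin[mu _].
  rewrite leNgt; apply/negP => uL.
  have : (leftmost c m < (u + 1)%R%:E)%E.
    by apply/H; exists u; [lia|apply: le_trans mu; rewrite lee_fin].
  case: (leftmost c m) uL => [v| |] //; rewrite !lte_fin; lia.
case E : (leftmost c m) => [v| |] //; last first.
  have /H' : (leftmost c m' < (0:int)%:E)%E by rewrite E' ltNyr.
  move=> [y y0 my]; have : (leftmost c m < 0%:E)%E.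
    by apply/H; exists y => //; apply: le_trans my; rewrite lee_fin.
  by rewrite E.
have /H' : (leftmost c m' < v%:E)%E by rewrite E' ltNyr.
move=> [y yv my]; have : (leftmost c m < v%:E)%E.
  by apply/H; exists y => //; apply: le_trans my; rewrite lee_fin.
by rewrite E ltxx.
Qed.

(** * The determinant *)

(** The expectation of [f] at the end of the run, when the items of the schedule
    act independently with probabilities [pi]. *)
Fixpoint mean {R : realType} {I S : Type} (pi : I -> R) (act : I -> S -> S)
    (f : S -> R) (l : seq I) (s : S) : R :=
  if l is p :: l' then
    pi p * mean pi act f l' (act p s) + (1 - pi p) * mean pi act f l' s
  else f s.

(** The zero block has [k - r] rows and [r + 1] columns, so no permutation
    avoids it. *)
Lemma det_zero_block {R : comPzRingType} {k : nat} (A : 'M[R]_k) (r : 'I_k) :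
  (forall i j : 'I_k, (r <= i)%N -> (j <= r)%N -> A i j = 0) -> \det A = 0.
Proof.
move=> A0; rewrite /determinant big1// => s _.
suff [i ri jr] : exists2 i : 'I_k, (r <= i)%N & (s i <= r)%N.
  by rewrite (bigD1 i)//= A0// mul0r mulr0.
apply: contrapT => H.
pose B := [set i : 'I_k | (r <= i)%N]%SET.
have sB : (s @: B \subset B :\ r)%SET.
  apply/fintype.subsetP => y /imsetP[i]; rewrite inE => ri -> {y}.
  rewrite !inE; suff : (r < s i)%N by move=> rs; rewrite gt_eqF// ltnW.
  by rewrite ltnNge; apply/negP => sr; apply: H; exists i.
have := subset_leq_card sB; rewrite card_imset; last exact: perm_inj.
by rewrite (cardsD1 r B) inE leqnn ltnn.
Qed.

(** If [mu i < x i] for all [i], the matrix is lower triangular with unit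
    diagonal; if [x r <= mu r], monotonicity gives a zero block of rows from [r]
    on and columns up to [r]. *)
Lemma det_threshold {R : comPzRingType} {k : nat} (mu : 'I_k -> \bar int)
    (x : 'I_k -> int) :
  (forall i j : 'I_k, (i <= j)%N -> (mu i <= mu j)%E) ->
  (forall i j : 'I_k, (i <= j)%N -> x i <= x j) ->
  \det (\matrix_(i, j) ((mu i < (x j)%:E)%E%:R - (i < j)%N%:R) : 'M[R]_k) =
  [forall i, (mu i < (x i)%:E)%E]%:R.
Proof.
move=> mu_le x_le; case: forallP => [H|/forallP].
  rewrite det_trig; last first.
    apply/is_trig_mxP => i j ij; rewrite !mxE ij.
    have -> : (mu i < (x j)%:E)%E; last by rewrite subrr.
    by apply: lt_le_trans (H i) _; rewrite lee_fin x_le// ltnW.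
  by rewrite big1// => i _; rewrite !mxE H ltnn subr0.
rewrite negb_forall => /existsP[r]; rewrite -leNgt => xr.
apply: (@det_zero_block _ _ _ r) => i j ri jr; rewrite mxE.
rewrite ltNge (_ : ((x j)%:E <= mu i)%E); last first.
  apply: le_trans (mu_le r i ri); apply: le_trans xr.
  by rewrite lee_fin x_le.
by rewrite ltnNge (leq_trans jr ri) subr0.
Qed.

Lemma det_sub_row {R : comPzRingType} {k : nat} (A : 'M[R]_k) (r : 'I_k)
    (B : {pred 'I_k}) : (forall i, i \in B -> (r < i)%N) ->
  \det (\matrix_(i, j) (A i j - (i \in B)%:R * A r j)) = \det A.
Proof.
move=> rB.
pose T : 'M[R]_k := \matrix_(i, j) ((i == j)%:R - ((i \in B) && (j == r))%:R).
have -> : \matrix_(i, j) (A i j - (i \in B)%:R * A r j) = T *m A.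
  apply/matrixP => i j; rewrite !mxE.
  under eq_bigr do rewrite mxE mulrBl.
  rewrite sumrB (bigD1 i)//= eqxx mul1r big1 ?addr0; last first.
    by move=> l li; rewrite eq_sym (negbTE li) mul0r.
  rewrite (bigD1 r)//= eqxx andbT [X in _ = _ - (_ + X)]big1 ?addr0//.
  by move=> l lr; rewrite (negbTE lr) andbF mul0r.
rewrite det_mulmx det_trig ?big1 ?mul1r//.
  move=> i _; rewrite mxE eqxx; case: andP => [[iB /eqP ir]|_].
    by have := rB i iB; rewrite ir ltnn.
  by rewrite subr0.
apply/is_trig_mxP => i j ij; rewrite mxE -val_eqE ltn_eqF// sub0r.
case: andP => [[iB /eqP jr]|_]; last by rewrite oppr0.
by have := rB i iB; move: ij; rewrite jr => /ltnW; rewrite leqNgt => /negbTE ->.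
Qed.

(** [C] mixes [A] and [A'] with weights [p] and [q] in the row [r], and the rows
    in [B] follow the row [r] up to constants.  After subtracting the row [r]
    from them, the three matrices differ in the row [r] only, and the
    determinant is linear in that row. *)
Lemma det_mix_rows {R : comPzRingType} {k : nat} (A A' C : 'M[R]_k) (p q : R)
    (r : 'I_k) (B : {pred 'I_k}) :
  (forall i, i \in B -> (r < i)%N) ->
  (forall j, C r j = p * A' r j + q * A r j) ->
  (forall i j, i \notin B -> i != r -> C i j = A i j /\ A' i j = A i j) ->
  (forall i j, i \in B ->
     C i j - C r j = A i j - A r j /\ A' i j - A' r j = A i j - A r j) ->
  \det C = p * \det A' + q * \det A.
Proof.
move=> rB Cr CA CB.
rewrite -(det_sub_row C rB) -(det_sub_row A' rB) -(det_sub_row A rB).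
have lr i : lift r i != r by rewrite eq_sym neq_lift.
have rNB : (r \in B) = false by apply/negP => /rB; rewrite ltnn.
apply: (determinant_multilinear (i0 := r)).
- apply/rowP => j; rewrite !mxE rNB !mul0r !subr0; exact: Cr.
- apply/matrixP => i j; rewrite !mxE.
  have [iB|iB] := boolP (lift r i \in B).
    by rewrite !mul1r; have [-> ->] := CB _ j iB.
  by rewrite !mul0r !subr0; have [-> ->] := CA _ j iB (lr i).
- apply/matrixP => i j; rewrite !mxE.
  have [iB|iB] := boolP (lift r i \in B).
    by rewrite !mul1r; have [-> _] := CB _ j iB.
  by rewrite !mul0r !subr0; have [-> _] := CA _ j iB (lr i).
Qed.

(** Induction on the schedule: the walks at the site of the first item move
    together or stay together, and their rows differ by
    [1_{r<j} - 1_{i<j}] in all three matrices. *)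
Lemma mean_det {R : realType} {I : Type} {k : nat} (pi : I -> R) (site : I -> int)
    (l : seq I) (mu : 'I_k -> \bar int) (x : 'I_k -> int) :
  (forall i j : 'I_k, (i <= j)%N -> (mu i <= mu j)%E) ->
  (forall i j : 'I_k, (i <= j)%N -> x i <= x j) ->
  mean pi (fun p nu i => move (site p) (nu i))
    (fun nu => [forall i, (nu i < (x i)%:E)%E]%:R) l mu =
  \det (\matrix_(i, j)
    (mean pi (fun p => move (site p)) (fun nu => (nu < (x j)%:E)%E%:R) l (mu i)
     - (i < j)%N%:R)).
Proof.
move=> + x_le; elim: l mu => [|p l IH] mu mu_le /=.
  by rewrite -det_threshold.
rewrite !IH//; last by move=> i j ij; apply/move_homo/mu_le.
pose v j nu : R :=
  mean pi (fun p => move (site p)) (fun nu => (nu < (x j)%:E)%E%:R) l nu.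
have [/existsP[i0 Hi0]|H0] := boolP [exists i, mu i == (site p)%:E].
  (* The least index makes the row operations triangular. *)
  pose r := [arg min_(i < i0 | mu i == (site p)%:E) i]%N.
  have [mur rmin] : mu r = (site p)%:E /\
      forall i, mu i = (site p)%:E -> (r <= i)%N.
    rewrite /r; case: arg_minnP => // i /eqP mi Hi; split => // j mj.
    by apply: Hi; apply/eqP.
  symmetry; apply: (@det_mix_rows _ _ _ _ _ _ _ r
    [pred i | (mu i == (site p)%:E) && (i != r)]).
  - move=> i /andP[/eqP mi ir]; rewrite ltn_neqAle rmin// andbT.
    by rewrite eq_sym.
  - by move=> j; rewrite !mxE; ring.
  - move=> i j; rewrite inE negb_and => + ir; rewrite ir orbF => mi.
    by rewrite !mxE /move (negbTE mi); split => //; ring.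
  - move=> i j /andP[/eqP mi ir]; rewrite !mxE mi mur; split; ring.
have mE i : move (site p) (mu i) = mu i.
  rewrite /move ifN//; apply: contra H0 => mi; apply/existsP; by exists i.
rewrite (_ : \matrix_(i, j) (mean _ _ _ l (move _ _) - _) =
             \matrix_(i, j) (v j (mu i) - (i < j)%N%:R)); last first.
  by apply/matrixP => i j; rewrite !mxE mE.
have mixE (a : R) : pi p * a + (1 - pi p) * a = a by ring.
rewrite mixE; congr (\det _).
by apply/matrixP => i j; rewrite !mxE mE mixE.
Qed.

(** * Runs driven by independent counts *)

Lemma measurable_run {d} {T : measurableType d} {I : Type} {S : Type}
    (act : I -> S -> S) (Psi : S -> bool) (X : I -> T -> nat) (l : seq I) (s : S) :
  (forall p, measurable_fun [set: T] (X p)) ->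
  measurable [set w | Psi (run act (fun p => 0 < X p w)%N l s)].
Proof.
move=> mX; elim: l s => [|p l IH] s /=.
  case: (Psi s); last by rewrite (_ : [set _ | _] = set0)//; apply/seteqP; split.
  by rewrite (_ : [set _ | _] = setT)//; apply/seteqP; split.
have -> : [set w | Psi (run act (fun p => 0 < X p w)%N l
                          (if (0 < X p w)%N then act p s else s))] =
    ((X p @^-1` [set n | (0 < n)%N])
      `&` [set w | Psi (run act (fun p => 0 < X p w)%N l (act p s))]) `|`
    ((X p @^-1` [set 0%N])
      `&` [set w | Psi (run act (fun p => 0 < X p w)%N l s)]).
  apply/seteqP; split=> w /=; first by case: (posnP (X p w)) => H; [right|left].
  by move=> [[H]|[-> ]]; rewrite ?H.
have mp (B : set nat) : measurable (X p @^-1` B).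
  by rewrite -[_ @^-1` _]setTI; apply: mX.
by apply: measurableU; apply: measurableI.
Qed.

(** The counts read by a schedule without repetition are independent, so each item
    can be integrated out in turn; the induction carries along the event fixed by
    the items that were already processed. *)
Lemma run_law {R : realType} {d} {T : measurableType d} (P : probability T R)
    {I : choiceType} {S : Type} (act : I -> S -> S) (Psi : S -> bool)
    (X : I -> T -> nat) (pi : I -> R) (l : seq I) (s : S) :
  (forall p, measurable_fun [set: T] (X p)) ->
  mutually_independent P X -> uniq l ->
  (forall p, p \in l -> P (X p @^-1` [set 0%N]) = (1 - pi p)%:E) ->
  P [set w | Psi (run act (fun p => 0 < X p w)%N l s)] =
  (mean pi act (fun s => (Psi s)%:R) l s)%:E.
Proof.
move=> mX indX ul P0.
(* [A l1 B]: the counts of the items of [l1] lie in the sets [B]. *)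
pose A (l1 : seq I) B := \bigcap_(i in [set` l1]) (X i @^-1` (B i : set nat)).
have mp p (B : set nat) : measurable (X p @^-1` B).
  by rewrite -[_ @^-1` _]setTI; apply: mX.
have mA l1 B : measurable (A l1 B).
  rewrite /A bigcap_seq; exact: bigsetI_measurable.
suff: forall l1 B, uniq (l1 ++ l) ->
    P (A l1 B `&` [set w | Psi (run act (fun p => 0 < X p w)%N l s)]) =
    (P (A l1 B) * (mean pi act (fun s => (Psi s)%:R) l s)%:E)%E.
  move=> /(_ [::] (fun=> setT) ul); rewrite /A set_nil bigcap_set0 setTI.
  by rewrite probability_setT mul1e.
elim: l s {ul} P0 => [|p l IH] s P0 l1 B ul /=.
  case: (Psi s).
    by rewrite mule1 (_ : [set _ | _] = setT) ?setIT//; apply/seteqP; split.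
  by rewrite mule0 (_ : [set _ | _] = set0) ?setI0 ?measure0//;
    apply/seteqP; split.
pose C (b : bool) : set nat := if b then [set n | (0 < n)%N] else [set 0%N].
pose B' b q := if q == p then C b else B q.
have /and4P[pl1 _ pl ull] : [&& p \notin l1, uniq l1, p \notin l & uniq (l1 ++ l)].
  move: ul; rewrite !cat_uniq /= negb_or.
  by move=> /and3P[-> /andP[-> ->] /andP[-> ->]].
have ul' : uniq ((p :: l1) ++ l) by rewrite /= mem_cat negb_or pl1 pl.
have AE b : A (p :: l1) (B' b) = (X p @^-1` C b) `&` A l1 B.
  apply/seteqP; split => [w H|w [H1 H2] q /=].
    split; first by have := H p (mem_head _ _); rewrite /= /B' eqxx.
    move=> q /= ql1; have := H q; rewrite /= inE ql1 orbT /B' => /(_ isT).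
    by rewrite ifN//; apply: contra pl1 => /eqP <-.
  rewrite inE /B'; case: eqP => [->//|_ /= ql1]; exact: H2.
have PA b : P (A (p :: l1) (B' b)) = (P (X p @^-1` C b) * P (A l1 B))%E.
  have mB q : measurable (B q) by [].
  have mB' q : measurable (B' b q) by [].
  rewrite /A indX//; last by move: ul'; rewrite cat_uniq => /andP[].
  rewrite indX//; last by move: ull; rewrite cat_uniq => /andP[].
  rewrite big_cons {1}/B' eqxx; congr (_ * _)%E.
  rewrite big_seq [RHS]big_seq; apply: eq_bigr => q ql1.
  by rewrite /B' ifN//; apply: contra pl1 => /eqP <-.
pose s' b := if b then act p s else s.
pose E b := [set w | Psi (run act (fun p => 0 < X p w)%N l (s' b))].
have -> : A l1 B `&` [set w | Psi (run act (fun p => 0 < X p w)%N l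
                          (if (0 < X p w)%N then act p s else s))] =
    (A (p :: l1) (B' true) `&` E true) `|` (A (p :: l1) (B' false) `&` E false).
  rewrite !AE; apply/seteqP; split=> w /=.
    by move=> [Aw]; case: (posnP (X p w)) => H Hr; [right|left].
  by move=> [[[H Aw]]|[[/= H Aw]]]; rewrite /E/= ?H//.
have mE b : measurable (E b) by apply: measurable_run.
have mAE b : measurable (A (p :: l1) (B' b) `&` E b) by exact: measurableI.
have -> : P ((A (p :: l1) (B' true) `&` E true) `|`
             (A (p :: l1) (B' false) `&` E false)) =
    (P (A (p :: l1) (B' true) `&` E true) +
     P (A (p :: l1) (B' false) `&` E false))%E.
  apply: measureU => //; rewrite !AE.
  apply/seteqP; split => // w [[[/= + _] _] [[/= + _] _]].
  by move=> /[swap] ->.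
have P0' q : q \in l -> P (X q @^-1` [set 0%N]) = (1 - pi q)%:E.
  by move=> ql; apply: P0; rewrite inE ql orbT.
rewrite (IH (s' true) P0' _ (B' true) ul') (IH (s' false) P0' _ (B' false) ul').
have fA : P (A l1 B) \is a fin_num by rewrite fin_num_measure.
have PF : P (X p @^-1` C false) = (1 - pi p)%:E by apply: P0; rewrite mem_head.
have PT : P (X p @^-1` C true) = (pi p)%:E.
  have -> : X p @^-1` C true = ~` (X p @^-1` C false).
    by apply/seteqP; split => w /=; rewrite lt0n => /eqP.
  rewrite probability_setC// PF -EFinB; congr EFin; ring.
rewrite !PA PF PT -(fineK fA) -!EFinM -EFinD; congr EFin.
by rewrite /s'; ring.
Qed.

(** * Sample paths in a time slot *)

(** Induction along an interval of reals; the supremum of the points up to which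
    [Q] holds can neither fail [Q] nor be smaller than [b]. *)
Lemma real_induction {R : realType} (Q : R -> Prop) (a b : R) : a <= b ->
  Q a ->
  (forall s, a <= s < b -> Q s -> \forall u \near s^'+, Q u) ->
  (forall s, a < s <= b -> (forall u, a <= u < s -> Q u) -> Q s) ->
  Q b.
Proof.
move=> ab Qa Qr Ql.
pose A := [set u | a <= u <= b /\ forall v, a <= v <= u -> Q v].
have Aa : A a.
  by split; [rewrite lexx|move=> v /andP[av va]; have -> : v = a by lra].
have ubA : ubound A b by move=> u [/andP[]].
have hA : has_sup A by split; [exists a|exists b].
pose c := sup A.
have ac : a <= c by apply: (ub_le_sup hA.2).
have cb : c <= b by apply: (ge_sup hA.1).
have Qlt v : a <= v < c -> Q v.
  move=> /andP[av /(sup_gt hA.1)[u [_ Qu] vu]].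
  by apply: Qu; rewrite av ltW.
have Ac : A c.
  split=> [|v /andP[av vc]]; first by rewrite ac.
  have [->|v_c] := eqVneq v c; last by apply: Qlt; rewrite av lt_neqAle v_c.
  have [a_c|c_a] := ltP a c; first by apply: Ql; rewrite ?a_c.
  by have -> : c = a by lra.
have [->|cNb] := eqVneq b c; first by apply: Ac.2; rewrite ac lexx.
have {cNb}c_b : c < b by rewrite lt_neqAle eq_sym cNb cb.
have : \forall u \near c^'+, Q u /\ u < b.
  near=> u; split; last by near: u; exact: nbhs_right_lt.
  near: u; apply: Qr; first by rewrite ac.
  by apply: Ac.2; rewrite ac lexx.
rewrite /at_right near_withinE => /nbhs_ballP[e /= e0 He].
have He' u : c < u -> u < c + e -> Q u /\ u < b.
  by move=> cu uce; apply: He => //; rewrite /ball/= ltr_norml; lra.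
have [_ ub] : Q (c + e / 2) /\ c + e / 2 < b by apply: He'; lra.
have : A (c + e / 2).
  split=> [|v /andP[av vc]]; first by lra.
  have [vlc|cv] := leP v c; first by apply: Ac.2; rewrite av.
  by have [] : Q v /\ v < b by apply: He'; lra.
by move=> /(ub_le_sup hA.2); rewrite -/c; lra.
Unshelve. all: by end_near. Qed.

Lemma near_left_wit {R : realType} (Q : R -> Prop) (a s : R) : a < s ->
  (\forall u \near s^'-, Q u) -> exists2 u, a <= u < s & Q u.
Proof.
move=> as_ Qs.
have : \forall u \near s^'-, a <= u < s /\ Q u.
  near=> u; split; last by near: u.
  apply/andP; split; last by near: u; exact: nbhs_left_lt.
  by apply: ltW; near: u; exact: nbhs_left_gt.
by move=> /filter_ex[u [? ?]]; exists u.
Unshelve. all: by end_near. Qed.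

Definition clock_ok {R : realType} (N : int -> R -> nat) : Prop := forall x,
  [/\ N x 0 = 0%N,
      (forall s t, 0 <= s <= t -> (N x s <= N x t)%N)
    & forall t, 0 <= t -> \forall s \near t^'+, N x s = N x t].

Lemma not_rings {R : realType} (c : R -> nat) (a b s : R) :
  (forall s t, 0 <= s <= t -> (c s <= c t)%N) -> 0 <= a -> a < s <= b ->
  c b = c a -> ~ rings c s.
Proof.
move=> c_le a0 /andP[as_ sb] cba [s0 H].
have := H a ltac:(by rewrite a0); have := c_le s b ltac:(by lra).
by rewrite cba; lia.
Qed.

(** The path is followed by induction over time, at the two sites that the clock
    of [z] acts on and separately at each other site.  As the clock rings at most
    once, the state just before the ring is still the state at time [a]. *)
Lemma tasep_slot {R : realType} (A : set int) (N : int -> R -> nat) eta0 eta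
    (z : int) (a b : R) :
  clock_ok N -> tasep_path A N eta0 eta -> 0 <= a <= b -> A z ->
  (forall q, A q -> q != z -> N q b = N q a) -> (N z b <= (N z a).+1)%N ->
  eta b = if (N z a < N z b)%N then attempt z (eta a) else eta a.
Proof.
move=> Nok [_ rc ringj noring] /andP[a0 ab] Az Nq Nz.
have [_ Nz_le Nz_rc] := Nok z.
have nring q s : q != z -> a < s <= b -> ~ (A q /\ rings (N q) s).
  move=> qz asb [Aq rq]; have [_ Nle _] := Nok q.
  exact: (not_rings Nle a0 asb (Nq _ Aq qz)).
pose Q x s := eta s x = if (N z a < N z s)%N then attempt z (eta a) x else eta a x.
have Q0 x : Q x a by rewrite /Q ltnn.
have Qr x s : a <= s < b -> Q x s -> \forall u \near s^'+, Q x u.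
  move=> /andP[as_ sb] Qs; have s0 : 0 <= s by apply: le_trans as_.
  near=> u; rewrite /Q (_ : eta u x = eta s x); last by near: u; exact: rc.
  by rewrite (_ : N z u = N z s)//; near: u; exact: Nz_rc.
have Qstill x s : x = z - 1 \/ x = z -> a < s <= b -> ~ rings (N z) s ->
    (forall u, a <= u < s -> Q x u) -> Q x s.
  move=> xz /andP[as_ sb] /not_andP nr Qu.
  have s0 : 0 < s by apply: le_lt_trans as_.
  have [//|/existsNP[v /not_implyP[/andP[v0 vs] /negP]]] := nr.
  rewrite -leqNgt => Nzv.
  have : \forall u \near s^'-, eta s x = eta u x.
    apply: noring => //.
      case: xz => ->; last by move=> [_ rz]; case: nr => // nr; apply: nr; case: rz.
      apply: nring; last by rewrite as_.
      by lia.
    case: xz => ->; last by apply: nring; [lia|rewrite as_].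
    by rewrite subrK => -[_ rz]; case: nr => // nr; apply: nr; case: rz.
  move=> /(near_left_wit (a := Num.max a v)); rewrite gt_max as_ vs.
  move=> /(_ isT)[u]; rewrite ge_max => /andP[/andP[au vu] us] eq_su.
  have := Qu u; rewrite au us => /(_ isT); rewrite /Q -eq_su.
  suff -> : N z u = N z s by [].
  apply/eqP; rewrite eqn_leq Nz_le ?(ltW us) ?(le_trans a0)//=.
  by apply: leq_trans Nzv _; rewrite Nz_le// v0.
have Qring s : a < s <= b -> rings (N z) s ->
    (forall u, a <= u < s -> Q (z - 1) u /\ Q z u) -> Q (z - 1) s /\ Q z s.
  move=> /andP[as_ sb] rz Qu.
  have s0 : 0 < s by apply: le_lt_trans as_.
  have /(near_left_wit as_)[u /andP[au us] [e1 e2]] :=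
    ringj s z s0 (conj Az rz).
  have [] := Qu u; first by rewrite au us.
  have Nus : (N z u < N z s)%N by apply: rz.2; rewrite us (le_trans a0).
  have Nsb : (N z s <= N z b)%N by apply: Nz_le; lra.
  have Nau : (N z a <= N z u)%N by apply: Nz_le; lra.
  have Nua : N z u = N z a by lia.
  rewrite /Q Nua ltnn e1 e2 (leq_ltn_trans Nau Nus) /attempt !eqxx => -> ->.
  by split.
(* The attempt couples [z - 1] and [z], so their inductions run jointly. *)
apply/funext => x; case: (pselect (x = z - 1 \/ x = z)) => xz.
  have [Q1 Q2] : Q (z - 1) b /\ Q z b.
    apply: (real_induction (Q := fun s => Q (z - 1) s /\ Q z s) ab) => //.
      move=> s asb [Q1 Q2]; near=> u; split; near: u; exact: Qr.
    move=> s asb Qu; have [rz|nr] := pselect (rings (N z) s).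
      exact: Qring.
    by split; apply: Qstill => //; [left|move=> u /Qu[]|right|move=> u /Qu[]].
  by case: xz => ->; case: ifP Q1 Q2; rewrite /Q => ->.
have -> : (if (N z a < N z b)%N then attempt z (eta a) else eta a) x = eta a x.
  case: ifP => // _; rewrite /attempt; case: ifP => // _.
  case: eqP => [xz1|_]; first by case: xz; left.
  by case: eqP => // xz1; case: xz; right.
apply: (real_induction (Q := fun s => eta s x = eta a x) ab) => //.
  move=> s /andP[as_ sb] es; near=> u; rewrite -es; near: u; apply: rc.
  exact: le_trans as_.
move=> s /andP[as_ sb] eu.
have s0 : 0 < s by apply: le_lt_trans as_.
have /(near_left_wit as_)[u asu ->] : \forall u \near s^'-, eta s x = eta u x.
  apply: noring => //; apply: nring; rewrite ?as_//.
    by apply/eqP => xz1; apply: xz; right.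
  by apply/eqP => xz1; apply: xz; left; lia.
exact: eu.
Unshelve. all: by end_near. Qed.

Lemma walk_le {R : realType} (N : int -> R -> nat) x0 xi (a b : R) :
  walk_path N x0 xi -> 0 <= a <= b -> xi b <= xi a.
Proof.
move=> [_ rc jump] /andP[a0 ab].
apply: (real_induction (Q := fun s => xi s <= xi a) ab) => //.
  move=> s /andP[as_ sb] es; near=> u.
  rewrite (_ : xi u = xi s)//; near: u; apply: rc; exact: le_trans as_.
move=> s /andP[as_ sb] eu.
have s0 : 0 < s by apply: le_lt_trans as_.
have /(near_left_wit as_)[u asu [H1 H2]] := jump s s0.
apply: le_trans (eu _ asu).
by have [/H1|/H2] := pselect (rings (N (xi u)) s) => ->; lia.
Unshelve. all: by end_near. Qed.

(** After its jump from [y] the walker may be at a site outside [B], whose clock is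
    not controlled; then only an upper bound on its position remains. *)
Lemma walk_slot {R : realType} (N : int -> R -> nat) x0 xi (B : set int)
    (y : int) (a b : R) :
  clock_ok N -> walk_path N x0 xi -> 0 <= a <= b -> xi a = y ->
  (forall q, B q -> q != y -> N q b = N q a) -> (N y b <= (N y a).+1)%N ->
  if (N y a < N y b)%N then xi b < y /\ (B (y - 1) -> xi b = y - 1)
  else xi b = y.
Proof.
move=> Nok wp /andP[a0 ab] xia Nq Ny; have [_ rc jump] := wp.
have [_ Ny_le Ny_rc] := Nok y.
pose Q s := if (N y a < N y s)%N then xi s < y /\ (B (y - 1) -> xi s = y - 1)
  else xi s = y.
apply: (real_induction (Q := Q) ab); first by rewrite /Q ltnn.
  move=> s /andP[as_ sb] Qs; have s0 : 0 <= s by apply: le_trans as_.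
  near=> u; rewrite /Q (_ : xi u = xi s); last by near: u; exact: rc.
  by rewrite (_ : N y u = N y s)//; near: u; exact: Ny_rc.
move=> s /andP[as_ sb] Qu.
have s0 : 0 < s by apply: le_lt_trans as_.
have [rcy|/not_andP nr] := pselect (rings (N y) s).
  have /(near_left_wit as_)[u /andP[au us] [H1 _]] := jump s s0.
  have := Qu u; rewrite au us => /(_ isT).
  have Nus : (N y u < N y s)%N by apply: rcy.2; rewrite us (le_trans a0).
  have Nsb : (N y s <= N y b)%N by apply: Ny_le; lra.
  have Nau : (N y a <= N y u)%N by apply: Ny_le; lra.
  have Nua : N y u = N y a by lia.
  rewrite /Q Nua ltnn (leq_ltn_trans Nau Nus) => xiu; move: H1; rewrite xiu.
  by move=> ->//; split=> //; lia.
have [//|/existsNP[v /not_implyP[/andP[v0 vs] /negP]]] := nr.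
rewrite -leqNgt => Nyv.
have as' : Num.max a v < s by rewrite gt_max as_ vs.
have /(near_left_wit as')[u] := jump s s0.
rewrite ge_max => /andP[/andP[au vu] us] [H1 H2].
have Nus : N y u = N y s.
  apply/eqP; rewrite eqn_leq Ny_le ?(ltW us) ?(le_trans a0)//=.
  by apply: leq_trans Nyv _; rewrite Ny_le// v0.
have := Qu u; rewrite au us => /(_ isT); rewrite /Q Nus.
case: ifP => NN; last first.
  by move=> xiu; rewrite H2// xiu => -[_ /(_ v)]; rewrite v0 vs => /(_ isT); lia.
move=> [xiu BQ]; have xis : xi s <= xi u by apply: (walk_le wp); lra.
split=> [|By]; first by lia.
rewrite H2; first exact: BQ.
rewrite BQ//; have [_ Nle _] := Nok (y - 1).
have asb : a < s <= b by rewrite as_ sb.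
by apply: (not_rings Nle a0 asb); apply: Nq => //; lia.
Unshelve. all: by end_near. Qed.

(** * The discretised clocks *)

Definition window (n : nat) : seq int :=
  [seq k%:Z - n%:Z | k <- iota 0 n.*2.+1].

Lemma mem_window n (z : int) : (z \in window n) = (`|z| <= n%:Z).
Proof.
apply/mapP/idP => [[k]|zn]; first by rewrite mem_iota => kn ->; lia.
by exists `|(z + n%:Z)%R|%N; rewrite ?mem_iota; lia.
Qed.

Lemma window_uniq n : uniq (window n).
Proof. by rewrite map_inj_uniq ?iota_uniq// => k k'; lia. Qed.

Definition slot (n j : nat) : seq (int * nat) := [seq (z, j) | z <- window n].

Definition schedule (n M : nat) : seq (int * nat) :=
  flatten [seq slot n j | j <- iota 0 M].

Lemma mem_slot n j p : (p \in slot n j) = (p.1 \in window n) && (p.2 == j).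
Proof.
apply/mapP/andP => [[z zn ->]|]; first by split.
by case: p => z i /= [zn /eqP ->]; exists z.
Qed.

Lemma schedule_rcons n M : schedule n M.+1 = schedule n M ++ slot n M.
Proof. by rewrite /schedule -addn1 iotaD map_cat flatten_cat /= cats0. Qed.

Lemma mem_schedule n M p :
  (p \in schedule n M) = (p.1 \in window n) && (p.2 < M)%N.
Proof.
elim: M => [|M IH]; first by rewrite ltn0 andbF.
by rewrite schedule_rcons mem_cat IH mem_slot -andb_orr ltnS [in RHS]leq_eqVlt orbC.
Qed.

Lemma slot_uniq n j : uniq (slot n j).
Proof. by rewrite map_inj_uniq ?window_uniq// => k k' []. Qed.

Lemma schedule_uniq n M : uniq (schedule n M).
Proof.
elim: M => // M IH; rewrite schedule_rcons cat_uniq IH slot_uniq andbT.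
apply/hasPn => p; rewrite mem_slot mem_schedule => /andP[-> /eqP ->].
by rewrite ltnn.
Qed.

Definition grid {R : realType} (t : R) (M j : nat) : R := j%:R * (t / M%:R).

Definition incr {R : realType} (N : int -> R -> nat) (r : nat -> R)
    (p : int * nat) : nat := (N p.1 (r p.2.+1) - N p.1 (r p.2))%N.

Definition sparse {R : realType} (N : int -> R -> nat) (r : nat -> R)
    (n M : nat) : Prop :=
  forall j, (j < M)%N ->
    (forall z, z \in window n -> (incr N r (z, j) <= 1)%N) /\
    (forall z z', z \in window n -> z' \in window n -> z != z' ->
       incr N r (z, j) = 0%N \/ incr N r (z', j) = 0%N).

(** In a slot without any ring an arbitrary site of the window can serve as [z]. *)
Lemma sparse_slot {R : realType} (N : int -> R -> nat) (r : nat -> R) n M j :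
  clock_ok N -> (forall i, 0 <= r i <= r i.+1) -> sparse N r n M -> (j < M)%N ->
  exists z, [/\ z \in window n, (N z (r j.+1) <= (N z (r j)).+1)%N &
    forall q, q \in window n -> q != z -> N q (r j.+1) = N q (r j)].
Proof.
move=> Nok r_le sp jM; have [s1 s2] := sp j jM.
have N_le q : (N q (r j) <= N q (r j.+1))%N.
  by have [_ + _] := Nok q; apply.
have incr0 q : incr N r (q, j) = 0%N -> N q (r j.+1) = N q (r j).
  by rewrite /incr /=; have := N_le q; lia.
have [[z [zn iz]]|H] :=
    pselect (exists z, z \in window n /\ incr N r (z, j) <> 0%N).
  exists z; split=> // [|q qn qz]; first by have := s1 z zn; rewrite /incr/=; lia.
  by apply: incr0; case: (s2 q z qn zn qz).
have all0 q : q \in window n -> incr N r (q, j) = 0%N.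
  by move=> qn; apply: contrapT => iq; apply: H; exists q.
have w0 : 0 \in window n by rewrite mem_window normr0.
exists 0; split=> // [|q qn _]; last exact/incr0/all0.
by rewrite (incr0 0 (all0 _ w0)).
Qed.

Definition bits {R : realType} (N : int -> R -> nat) (r : nat -> R)
    (p : int * nat) : bool := (0 < incr N r p)%N.

Lemma run_slot {R : realType} {S : Type} (act : int -> S -> S)
    (N : int -> R -> nat) (r : nat -> R) n j z s : z \in window n ->
  (forall q, q \in window n -> q != z -> N q (r j.+1) = N q (r j)) ->
  run (fun p => act p.1) (bits N r) (slot n j) s =
  if (N z (r j) < N z (r j.+1))%N then act z s else s.
Proof.
move=> zn Nq; rewrite (run_single _ (p := (z, j))) ?slot_uniq//; last first.
  move=> [q i]; rewrite mem_slot => /andP[/= qn /eqP ->]; rewrite /bits /incr /=.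
  rewrite subn_gt0 => Nqi; congr pair; apply/eqP; apply: contraLR Nqi => qz.
  by rewrite Nq// ltnn.
by rewrite mem_slot zn eqxx /bits /incr /= subn_gt0.
Qed.

Lemma tasep_run {R : realType} (N : int -> R -> nat) eta0 eta (r : nat -> R) n M :
  clock_ok N -> tasep_path [set x : int | `|x| <= n%:Z] N eta0 eta ->
  r 0%N = 0 -> (forall i, r i <= r i.+1) -> sparse N r n M ->
  eta (r M) = run (fun p => attempt p.1) (bits N r) (schedule n M) eta0.
Proof.
move=> Nok eta_path r0 r_le sp.
have r_ge0 i : 0 <= r i by elim: i => [|i IH]; rewrite ?r0// (le_trans IH).
suff H J : (J <= M)%N ->
    eta (r J) = run (fun p => attempt p.1) (bits N r) (schedule n J) eta0.
  exact: H.
elim: J => [_|J IH JM].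
  by have [eta0E _ _ _] := eta_path; rewrite r0; apply/funext.
have r_le' i : 0 <= r i <= r i.+1 by rewrite r_ge0 r_le.
have [z [zn Nz Nq]] := sparse_slot Nok r_le' sp JM.
rewrite schedule_rcons run_cat -(IH (ltnW JM)) (run_slot _ _ zn Nq).
apply: (tasep_slot Nok eta_path) => //=; first by rewrite -mem_window.
by move=> q; rewrite -mem_window; exact: Nq.
Qed.

(** The run agrees with the walker until the walker drops below [-n]; from then on
    both stay below [-n], which suffices since [-n <= x].  Sites to the right of
    [x0] do not matter because walkers only move to the left. *)
Lemma walk_run {R : realType} (N : int -> R -> nat) x0 xi (r : nat -> R) n M x :
  clock_ok N -> walk_path N x0 xi ->
  r 0%N = 0 -> (forall i, r i <= r i.+1) -> sparse N r n M ->
  x0 <= n%:Z -> - n%:Z <= x ->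
  (run (fun p => move p.1) (bits N r) (schedule n M) x0%:E < x%:E)%E =
  (xi (r M) < x).
Proof.
move=> Nok xi_path r0 r_le sp x0n nx.
have r_ge0 i : 0 <= r i by elim: i => [|i IH]; rewrite ?r0// (le_trans IH).
pose mu J := run (fun p => move p.1) (bits N r) (schedule n J) x0%:E.
suff H J : (J <= M)%N -> mu J = (xi (r J))%:E \/
    (xi (r J) < - n%:Z /\ (mu J < (- n%:Z)%:E)%E).
  have [E|[xin mun]] := H M (leqnn M); first by rewrite -/(mu M) E lte_fin.
  by rewrite (lt_le_trans xin nx) (lt_le_trans mun)// lee_fin.
elim: J => [_|J IH JM].
  by left; have [E _ _] := xi_path; rewrite /mu /= r0 E.
have r_le' i : 0 <= r i <= r i.+1 by rewrite r_ge0 r_le.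
have xi_J : xi (r J.+1) <= xi (r J) by apply: walk_le xi_path _.
have muS : (mu J.+1 <= mu J)%E.
  rewrite /mu schedule_rcons run_cat.
  set nu := run _ _ (schedule n J) _.
  apply: (run_inv (Q := fun u => (u <= nu)%E)) => // p s snu.
  exact: le_trans (move_le _ _) snu.
have [muE|[xin mun]] := IH (ltnW JM); last first.
  by right; split; [exact: le_lt_trans xin|exact: le_lt_trans mun].
have [xin|nxi] := ltP (xi (r J)) (- n%:Z).
  right; split; first exact: le_lt_trans xin.
  by apply: le_lt_trans muS _; rewrite muE lte_fin.
have [z [zn Nz Nq]] := sparse_slot Nok r_le' sp JM.
have xi_n : xi (r J) <= n%:Z.
  apply: le_trans x0n; have [<- _ _] := xi_path.
  by apply: walk_le xi_path _; rewrite lexx r_ge0.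
have xi_w : xi (r J) \in window n by rewrite mem_window; lia.
have muSE : mu J.+1 =
    if (N z (r J) < N z (r J.+1))%N then move z (xi (r J))%:E else (xi (r J))%:E.
  by rewrite -muE /mu schedule_rcons run_cat (run_slot _ _ zn Nq).
have [xiz|xiz] := eqVneq (xi (r J)) z.
  have := walk_slot (B := [set q | q \in window n]) Nok xi_path (r_le' J) xiz Nq Nz.
  rewrite muSE /= /move xiz eqxx mem_window; case: ifP => _; last by move=> ->; left.
  move=> [lez eqz]; have [zn1|zn1] := leP (`|z - 1|) n%:Z.
    by left; rewrite eqz.
  right; rewrite lte_fin; split; lia.
have Nxi : N (xi (r J)) (r J.+1) = N (xi (r J)) (r J) by apply: Nq.
have := walk_slot (B := set0) Nok xi_path (r_le' J) erefl.
rewrite Nxi ltnn => /(_ _ (leqnSn _)) xiE; left.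
rewrite muSE xiE// /move; case: ifP => //; case: eqP => // -[xz].
by rewrite xz eqxx in xiz.
Qed.

(** * Two rings in one slot *)

Lemma grid0 {R : realType} (t : R) M : grid t M 0 = 0.
Proof. by rewrite /grid mul0r. Qed.

Lemma grid_le {R : realType} (t : R) M j : 0 <= t -> grid t M j <= grid t M j.+1.
Proof.
by move=> t0; rewrite /grid ler_wpM2r ?ler_nat// divr_ge0.
Qed.

Lemma grid_ge0 {R : realType} (t : R) M j : 0 <= t -> 0 <= grid t M j.
Proof. by move=> t0; rewrite /grid mulr_ge0// divr_ge0. Qed.

Lemma grid_last {R : realType} (t : R) M : (0 < M)%N -> grid t M M = t.
Proof. by move=> M0; rewrite /grid mulrC divfK// pnatr_eq0 -lt0n. Qed.

Lemma grid_step {R : realType} (t : R) M j :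
  grid t M j.+1 - grid t M j = t / M%:R.
Proof. by rewrite /grid -natr1; ring. Qed.

Definition ring_prob {R : realType} (lambda : int -> R) (t : R) (M : nat)
  (p : int * nat) : R := 1 - expR (- (lambda p.1 * (t / M%:R))).

Definition ticks {R : realType} {T : Type} (N : int -> R -> T -> nat) (t : R)
    (M : nat) (p : int * nat) (w : T) : nat :=
  incr (fun z s => N z s w) (grid t M) p.

(** Two rings in the slot [q.1], at the sites [q.2]; coinciding sites stand for two
    rings of the same clock. *)
Definition crowd {R : realType} {T : Type} (N : int -> R -> T -> nat) (t : R)
    (M : nat) (q : nat * (int * int)) : set T :=
  if q.2.1 == q.2.2 then ticks N t M (q.2.1, q.1) @^-1` [set n | (1 < n)%N]
  else ticks N t M (q.2.1, q.1) @^-1` [set n | (0 < n)%N] `&`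
       ticks N t M (q.2.2, q.1) @^-1` [set n | (0 < n)%N].

Definition crowded {R : realType} {T : Type} (N : int -> R -> T -> nat) (t : R)
    (M n : nat) : set T :=
  \big[setU/set0]_(q <- [seq (j, zz) | j <- iota 0 M,
      zz <- [seq (z, z') | z <- window n, z' <- window n]]) crowd N t M q.

Definition crowd_const {R : realType} (lambda : int -> R) (t : R) (n : nat) : R :=
  (\sum_(z <- window n) lambda z) ^+ 2 * t ^+ 2.

Lemma measurable_nat_preim {d} {T : measurableType d} (f : T -> nat) (B : set nat) :
  measurable_fun [set: T] f -> measurable (f @^-1` B).
Proof. by move=> mf; rewrite -[_ @^-1` _]setTI; apply: mf. Qed.

Lemma measurable_exists {d} {T : measurableType d} {I : countType}
    (Q : I -> T -> Prop) :
  (forall i, measurable [set w | Q i w]) -> measurable [set w | exists i, Q i w].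
Proof.
move=> mQ; rewrite (_ : [set w | _] = \bigcup_i [set w | Q i w]).
  exact: countable_bigcupT_measurable.
by apply/seteqP; split => [w [i Qi]|w [i _ Qi]]; exists i.
Qed.

Lemma measurable_subn {d} {T : measurableType d} (f g : T -> nat) :
  measurable_fun [set: T] f -> measurable_fun [set: T] g ->
  measurable_fun [set: T] (fun w => (f w - g w)%N).
Proof.
move=> mf mg _ B _; rewrite setTI.
have -> : (fun w => (f w - g w)%N) @^-1` B =
    [set w | exists ij : nat * nat,
      (f @^-1` [set i | i = ij.1 /\ B (ij.1 - ij.2)%N] `&` g @^-1` [set ij.2]) w].
  apply/seteqP; split => w /=; first by exists (f w, g w).
  by move=> [[i j] /= [[-> Bij] ->]].
by apply: measurable_exists => ij; apply: measurableI; exact: measurable_nat_preim.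
Qed.

Section ticks.
Context {R : realType} {d : measure_display} {T : measurableType d}.
Context {P : probability T R} {lambda : int -> R} {N : int -> R -> T -> nat}.
Context (lambda_gt0 : forall x, 0 < lambda x).
Context (clk : poisson_clocks P lambda N).
Context {t : R} {M : nat}.
Context (t_ge0 : 0 <= t).
Context (M_gt0 : (0 < M)%N).

Lemma measurable_ticks p : measurable_fun [set: T] (ticks N t M p).
Proof.
have [mN _ _ _] := clk; apply: measurable_subn; apply: mN; exact: grid_ge0.
Qed.

Lemma ticks_indep : mutually_independent P (ticks N t M).
Proof.
have [_ _ _ ind] := clk; apply: (ind (grid t M)); first exact: grid_ge0.
by move=> n; exact: grid_le.
Qed.

Lemma ticks_pmf p n : 0 < t ->
  P (ticks N t M p @^-1` [set n]) = (poisson_pmf (lambda p.1 * (t / M%:R)) n)%:E.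
Proof.
move=> t0; have [_ _ pois _] := clk; rewrite -(grid_step t M p.2).
apply: pois; rewrite grid_ge0//= /grid ltr_pM2r ?ltr_nat//.
by rewrite divr_gt0// ltr0n.
Qed.

Lemma ticks_t0 p w : t = 0 -> ticks N t M p w = 0%N.
Proof. by move=> t0; rewrite /ticks /incr /grid t0 !mul0r !mulr0 subnn. Qed.

Lemma ticks0 p : P (ticks N t M p @^-1` [set 0%N]) = (1 - ring_prob lambda t M p)%:E.
Proof.
rewrite /ring_prob opprB addrC subrK; case: (eqVneq t 0) => [t0|tN0].
  (* The Poisson law of the increments covers only slots of positive length. *)
  rewrite (_ : _ @^-1` _ = setT) ?probability_setT.
    by rewrite t0 mul0r mulr0 oppr0 expR0.
  by apply/seteqP; split => // w _; exact: ticks_t0.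
have t0 : 0 < t by rewrite lt_neqAle eq_sym tN0.
rewrite ticks_pmf// /poisson_pmf mulr_gt0 ?lambda_gt0// ?divr_gt0 ?ltr0n//.
by rewrite expr0 fact0 invr1 !mul1r.
Qed.

Lemma ticks_ge1 p : (P (ticks N t M p @^-1` [set n | (0 < n)%N]) <=
  (lambda p.1 * (t / M%:R))%:E)%E.
Proof.
have -> : ticks N t M p @^-1` [set n | (0 < n)%N] =
    ~` (ticks N t M p @^-1` [set 0%N]).
  by apply/seteqP; split => w /=; rewrite lt0n => /eqP.
rewrite probability_setC; last exact/measurable_nat_preim/measurable_ticks.
rewrite ticks0 -EFinB lee_fin opprB addrC subrK /ring_prob.
by have := expR_ge1Dx (- (lambda p.1 * (t / M%:R))); lra.
Qed.

(** With [a] the mean of the count, the probability is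
    [1 - (1 + a) exp (- a)], at most [1 - (1 + a) (1 - a)]. *)
Lemma ticks_ge2 p : (P (ticks N t M p @^-1` [set n | (1 < n)%N]) <=
  (lambda p.1 * lambda p.1 * (t / M%:R) ^+ 2)%:E)%E.
Proof.
have mC B : measurable (ticks N t M p @^-1` B).
  exact/measurable_nat_preim/measurable_ticks.
case: (eqVneq t 0) => [t0|tN0].
  rewrite (_ : _ @^-1` _ = set0) ?measure0 ?lee_fin.
    by rewrite t0 mul0r expr0n /= mulr0.
  by apply/seteqP; split => // w /=; rewrite ticks_t0.
have t0 : 0 < t by rewrite lt_neqAle eq_sym tN0.
have -> : ticks N t M p @^-1` [set n | (1 < n)%N] =
    ~` (ticks N t M p @^-1` [set 0%N] `|` ticks N t M p @^-1` [set 1%N]).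
  apply/seteqP; split => w /=; first by move=> + [e|e]; rewrite e.
  by case: (ticks N t M p w) => [|[|n]] //= []; [left|right].
rewrite probability_setC; last exact: measurableU.
have -> : P (ticks N t M p @^-1` [set 0%N] `|` ticks N t M p @^-1` [set 1%N]) =
    (P (ticks N t M p @^-1` [set 0%N]) + P (ticks N t M p @^-1` [set 1%N]))%E.
  by apply: measureU => //; apply/seteqP; split => // w [/= ->].
rewrite !ticks_pmf// /poisson_pmf.
have a0 : 0 < lambda p.1 * (t / M%:R).
  by rewrite mulr_gt0 ?lambda_gt0// ?divr_gt0 ?ltr0n.
set a := lambda p.1 * _ in a0 *; rewrite a0.
have -> (u v : R) : (1 - (u%:E + v%:E) = (1 - (u + v))%:E)%E by [].
rewrite lee_fin.
rewrite expr0 expr1 !factE /= invr1 !mulr1 mul1r.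
have -> : lambda p.1 * lambda p.1 * (t / M%:R) ^+ 2 = a ^+ 2 by rewrite /a; ring.
by have := expR_ge1Dx (- a); nra.
Qed.

Lemma measurable_crowd q : measurable (crowd N t M q).
Proof.
rewrite /crowd; case: ifP => _; last apply: measurableI.
all: exact/measurable_nat_preim/measurable_ticks.
Qed.

Lemma crowd_le q :
  (P (crowd N t M q) <= (lambda q.2.1 * lambda q.2.2 * (t / M%:R) ^+ 2)%:E)%E.
Proof.
rewrite /crowd; case: eqP => [<-|/eqP q12]; first exact: (ticks_ge2 (q.2.1, q.1)).
have := ticks_indep (s := [:: (q.2.1, q.1); (q.2.2, q.1)])
  (B := fun=> [set n | (0 < n)%N]).
rewrite /= inE andbT => H; have := H _ _; rewrite big_cons big_seq1.
rewrite (_ : \bigcap_(i in _) _ = ticks N t M (q.2.1, q.1) @^-1` [set n | (0 < n)%N] `&`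
       ticks N t M (q.2.2, q.1) @^-1` [set n | (0 < n)%N]); last first.
  apply/seteqP; split => [w Hw|w [H1 H2] p /=].
    by split; apply: Hw; rewrite /= !inE eqxx ?orbT.
  by rewrite !inE => /orP[/eqP ->|/eqP ->].
move=> ->//; last by apply: contra q12 => /eqP[->].
have -> : lambda q.2.1 * lambda q.2.2 * (t / M%:R) ^+ 2 =
  (lambda q.2.1 * (t / M%:R)) * (lambda q.2.2 * (t / M%:R)) by ring.
rewrite EFinM; apply: lee_pmul => //; first exact: (ticks_ge1 (q.2.1, q.1)).
exact: (ticks_ge1 (q.2.2, q.1)).
Qed.

Lemma measurable_crowded n : measurable (crowded N t M n).
Proof. by apply: bigsetU_measurable => q _; exact: measurable_crowd. Qed.

(** A union bound over [M] slots, each with probability of order [(t / M) ^ 2]. *)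
Lemma crowded_le n : (P (crowded N t M n) <= (crowd_const lambda t n / M%:R)%:E)%E.
Proof.
rewrite /crowded; set s := [seq _ | _ <- _, _ <- _].
apply: (@le_trans _ _ (\sum_(q <- s) P (crowd N t M q))%E).
  elim: s => [|q s IH]; first by rewrite !big_nil measure0.
  rewrite !big_cons; apply: (le_trans (measureU2 P _ _)).
  - exact: measurable_crowd.
  - by apply: bigsetU_measurable => i _; exact: measurable_crowd.
  - exact: leeD.
apply: (@le_trans _ _ (\sum_(q <- s)
    (lambda q.2.1 * lambda q.2.2 * (t / M%:R) ^+ 2)%:E)%E).
  by apply: lee_sum => q _; exact: crowd_le.
rewrite sumEFin lee_fin /s big_allpairs /=.
have slotE : \sum_(q <- [seq (z, z') | z <- window n, z' <- window n])
    (lambda q.1 * lambda q.2 * (t / M%:R) ^+ 2) =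
    (\sum_(z <- window n) lambda z) ^+ 2 * (t / M%:R) ^+ 2.
  set h2 := (t / M%:R) ^+ 2; rewrite big_allpairs /= expr2 -mulrA mulr_suml.
  by apply: eq_bigr => z _; rewrite -mulr_suml -mulr_sumr mulrA.
under eq_bigr do rewrite slotE.
rewrite big_const_seq count_predT size_iota iter_addr_0 /crowd_const -mulr_natr.
rewrite le_eqVlt; apply/orP; left; apply/eqP; field.
by rewrite pnatr_eq0 -lt0n.
Qed.

Lemma sparse_crowded n w :
  ~ crowded N t M n w -> sparse (fun z s => N z s w) (grid t M) n M.
Proof.
rewrite /crowded -bigcup_seq => nc j jM; split.
  move=> z zn; rewrite leqNgt; apply/negP => c2; apply: nc.
  exists (j, (z, z)); last by rewrite /crowd /= eqxx.
  apply/allpairsP; exists (j, (z, z)); split => //; first by rewrite mem_iota.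
  by apply/allpairsP; exists (z, z).
move=> z z' zn z'n zz'; apply: contrapT => /not_orP[c1 c2]; apply: nc.
exists (j, (z, z')); last first.
  rewrite /crowd /= (negbTE zz'); split; rewrite /= lt0n; exact/eqP.
apply/allpairsP; exists (j, (z, z')); split => //; first by rewrite mem_iota.
by apply/allpairsP; exists (z, z').
Qed.

End ticks.

(** * Limits of probabilities *)

Lemma cvg_dist_le {R : realType} (u v : nat -> R) (a : R) :
  (\forall n \near \oo, `|u n - a| <= v n) -> v n @[n --> \oo] --> 0 ->
  u n @[n --> \oo] --> a.
Proof.
move=> uv v0; apply: (@squeeze_cvgr _ _ _ _ (fun n => a - v n) (fun n => a + v n)).
- by near=> n; have : `|u n - a| <= v n by [near: n]; rewrite ler_norml; lra.
- by rewrite -[X in _ --> X]subr0; apply: cvgB => //; exact: cvg_cst.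
- by rewrite -[X in _ --> X]addr0; apply: cvgD => //; exact: cvg_cst.
Unshelve. all: by end_near. Qed.

Lemma cvg_det {R : realType} {k : nat} (A : nat -> 'M[R]_k) (B : 'M[R]_k) :
  (forall i j, A n i j @[n --> \oo] --> B i j) ->
  \det (A n) @[n --> \oo] --> \det B.
Proof.
move=> AB; rewrite /determinant.
apply: (@cvg_big R^o _ +%R 0 predT (@add_continuous _) _ \oo
  (index_enum {perm 'I_k}) (fun s n => (-1) ^+ s * \prod_i A n i (s i))
  (fun s => (-1) ^+ s * \prod_i B i (s i)) _) => s _.
apply: cvgM; first exact: cvg_cst.
by apply: (@cvg_big R^o _ *%R 1 predT (@mul_continuous _) _ \oo
  (index_enum 'I_k) (fun i n => A n i (s i)) (fun i => B i (s i)) _) => i _.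
Qed.

Lemma fine_prob_le {R : realType} {d} {T : measurableType d}
    (P : probability T R) (A B D : set T) :
  measurable A -> measurable B -> measurable D ->
  {ae P, forall w, A w -> B w \/ D w} ->
  fine (P A) <= fine (P B) + fine (P D).
Proof.
move=> mA mB mD [Z [mZ PZ0 sub]].
have fP C : measurable C -> P C \is a fin_num by move=> mC; rewrite fin_num_measure.
rewrite -fineD ?fP// fine_le// ?fin_numD ?fP//.
apply: (@le_trans _ _ (P ((B `|` D) `|` Z))).
  apply: le_measure; rewrite ?inE//.
    by apply: measurableU => //; exact: measurableU.
  move=> w Aw; have [BDw|nBD] := pselect (B w \/ D w); first by left.
  by right; apply: sub => /= /(_ Aw).
apply: le_trans (measureU2 P _ _) _ => //; first exact: measurableU.
by rewrite [X in (_ + X)%E]PZ0 adde0; exact: measureU2.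
Qed.

(** The limit superior of the events is negligible, and the events after the
    [n]-th have union of probability tending to that of the limit superior. *)
Lemma prob_vanish {R : realType} {d} {T : measurableType d}
    (P : probability T R) (A : nat -> set T) :
  (forall n, measurable (A n)) ->
  {ae P, forall w, \forall n \near \oo, ~ A n w} ->
  fine (P (A n)) @[n --> \oo] --> 0.
Proof.
move=> mA [Z [mZ PZ0 sub]].
have PL0 : P (lim_sup_set A) = 0%E.
  apply/eqP; rewrite eq_le measure_ge0 andbT -PZ0; apply: le_measure.
  - rewrite inE; apply: bigcap_measurableType => n _.
    by apply: bigcup_measurable.
  - by rewrite inE.
  - move=> w Lw; apply: sub => -[n _ An].
    by have [m nm Am] := Lw n I; exact: An Am.
apply: fine_cvg.
have cvU := lim_sup_set_cvg P A mA.
have {}cvU : P (\bigcup_(k in [set k | (n <= k)%N]) A k) @[n --> \oo] -->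
    P (lim_sup_set A).
  apply: cvU; apply: (@le_lt_trans _ _ 1%E); last exact: ltry.
  by apply: probability_le1; exact: bigcup_measurable.
rewrite PL0 in cvU.
apply: (@squeeze_cvge _ _ _ _ (fun=> 0%E) _
    (fun n => P (\bigcup_(k in [set k | (n <= k)%N]) A k))) => //; last exact: cvg_cst.
near=> n; rewrite measure_ge0/=; apply: le_measure; rewrite ?inE//.
  exact: bigcup_measurable.
by apply: bigcup_sup => /=.
Unshelve. all: by end_near. Qed.

(** The exceptional events [D] only need small probability, not to vanish
    pointwise; this is how crowded slots are discarded. *)
Lemma prob_cvg {R : realType} {d} {T : measurableType d}
    (P : probability T R) (A D : nat -> set T) (B : set T) :
  (forall n, measurable (A n)) -> (forall n, measurable (D n)) -> measurable B ->
  fine (P (D n)) @[n --> \oo] --> 0 ->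
  {ae P, forall w, \forall n \near \oo, ~ D n w -> (A n w <-> B w)} ->
  fine (P (A n)) @[n --> \oo] --> fine (P B).
Proof.
move=> mA mD mB D0 AB.
pose E n := ((A n `\` B) `|` (B `\` A n)) `\` D n.
have mE n : measurable (E n).
  by apply: measurableD => //; apply: measurableU; exact: measurableD.
have E0 : fine (P (E n)) @[n --> \oo] --> 0.
  apply: prob_vanish => //; apply: filterS AB => w; apply: filterS => n ABn.
  by move=> [[[Aw nB]|[Bw nA]] nD]; have [] := ABn nD; tauto.
apply: (@cvg_dist_le _ _ (fun n => fine (P (E n)) + fine (P (D n)))); last first.
  by rewrite -[X in _ --> X]addr0; exact: cvgD.
apply: nearW => n; rewrite ler_norml.
have mED : measurable (E n `|` D n) by exact: measurableU.
have ED : fine (P (E n `|` D n)) <= fine (P (E n)) + fine (P (D n)).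
  by apply: fine_prob_le => //; apply: aeW => w; exact.
have AB' : fine (P (A n)) <= fine (P B) + fine (P (E n `|` D n)).
  apply: fine_prob_le => //; apply: aeW => w Aw.
  have [Bw|nB] := pselect (B w); [by left|right].
  by have [Dw|nD] := pselect (D n w); [right|left; split=> //; left].
have BA : fine (P B) <= fine (P (A n)) + fine (P (E n `|` D n)).
  apply: fine_prob_le => //; apply: aeW => w Bw.
  have [Aw|nA] := pselect (A n w); [by left|right].
  by have [Dw|nD] := pselect (D n w); [right|left; split=> //; right].
lra.
Qed.

Lemma mean_fix {R : realType} {I S : Type} (pi : I -> R) (act : I -> S -> S)
    (f : S -> R) (l : seq I) (s : S) :
  (forall p, act p s = s) -> mean pi act f l s = f s.
Proof. by move=> H; elim: l => //= p l IH; rewrite H IH; ring. Qed.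

(** The probability that a discretised walker started at [mu] ends below [x].  It
    depends on the rates only, so that it can be compared with clocks on different
    probability spaces. *)
Definition hit {R : realType} (lambda : int -> R) (t : R) (n M : nat) (x : int)
    (mu : \bar int) : R :=
  mean (ring_prob lambda t M) (fun p => move p.1) (fun nu => (nu < x%:E)%E%:R)
    (schedule n M) mu.

Lemma measurable_guard {d} {T : measurableType d} (b : Prop) (A : set T) :
  measurable A -> measurable [set w | b /\ A w].
Proof.
move=> mA; have [bT|bF] := pselect b.
  by rewrite (_ : [set w | _] = A)//; apply/seteqP; split => [w []|w Aw].
by rewrite (_ : [set w | _] = set0)//; apply/seteqP; split => [w []|w].
Qed.

Lemma measurable_walker {R : realType} {d} {T : measurableType d}
    {P : probability T R} {lambda : int -> R} {x0 : int} {xi} (t : R) (x : int) :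
  is_walker P lambda x0 xi -> 0 <= t -> measurable [set w | xi t w < x].
Proof.
move=> [mxi _] t0; rewrite (_ : [set w | _] =
    [set w | exists v : int, v < x /\ [set w | xi t w = v] w]).
  by apply: measurable_exists => v; apply: measurable_guard; exact: mxi.
by apply/seteqP; split => [w xiw|w [v [vx /= ->]]//]; exists (xi t w).
Qed.

Lemma run_ticks_law {R : realType} {d} {T : measurableType d}
    {P : probability T R} {lambda : int -> R} {N : int -> R -> T -> nat} {S : Type}
    (act : int * nat -> S -> S) (Psi : S -> bool) (t : R) n M s :
  (forall x, 0 < lambda x) -> poisson_clocks P lambda N -> 0 <= t -> (0 < M)%N ->
  fine (P [set w | Psi (run act (bits (fun z s => N z s w) (grid t M))
    (schedule n M) s)]) =
  mean (ring_prob lambda t M) act (fun s => (Psi s)%:R) (schedule n M) s.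
Proof.
move=> l0 clk t0 M0.
have := @run_law _ _ _ P _ _ act Psi (ticks N t M) (ring_prob lambda t M)
  (schedule n M) s (measurable_ticks clk t0)
  (ticks_indep clk t0) (schedule_uniq n M)
  (fun p _ => ticks0 l0 clk t0 M0 p).
by move=> ->.
Qed.

Lemma measurable_run_ticks {R : realType} {d} {T : measurableType d}
    {P : probability T R} {lambda : int -> R} {N : int -> R -> T -> nat} {S : Type}
    (act : int * nat -> S -> S) (Psi : S -> bool) (t : R) n M s :
  poisson_clocks P lambda N -> 0 <= t ->
  measurable [set w | Psi (run act (bits (fun z s => N z s w) (grid t M))
    (schedule n M) s)].
Proof.
move=> clk t0; apply: (measurable_run act Psi (X := ticks N t M)).
by move=> p; exact: (measurable_ticks clk t0 p).
Qed.

Lemma crowded_cvg0 {R : realType} {d} {T : measurableType d}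
    {P : probability T R} {lambda : int -> R} {N : int -> R -> T -> nat} (t : R)
    (Ms : nat -> nat) :
  (forall x, 0 < lambda x) -> poisson_clocks P lambda N -> 0 <= t ->
  (forall n, (0 < Ms n)%N /\ crowd_const lambda t n / (Ms n)%:R <= n.+1%:R^-1) ->
  fine (P (crowded N t (Ms n) n)) @[n --> \oo] --> 0.
Proof.
move=> l0 clk t0 HM.
apply: (@cvg_dist_le _ _ (@harmonic R)); last exact: cvg_harmonic.
apply: nearW => n; have [M0 Mc] := HM n.
rewrite subr0 ger0_norm ?fine_ge0// /harmonic; apply: le_trans Mc.
have fin : P (crowded N t (Ms n) n) \is a fin_num.
  by rewrite fin_num_measure//; exact: (measurable_crowded clk t0).
by rewrite -lee_fin fineK//; exact: crowded_le.
Qed.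

(** A walker started at [x0] is followed exactly for comparison with [x] as soon as
    the window contains both, except when a slot is crowded. *)
Lemma hit_cvg {R : realType} {d} {T : measurableType d}
    {P : probability T R} {lambda : int -> R} (xi : int -> R -> T -> int) (t : R)
    (Ms : nat -> nat) (mu : \bar int) (x : int) :
  (forall x, 0 < lambda x) -> (forall x, is_walker P lambda x (xi x)) -> 0 <= t ->
  (forall n, (0 < Ms n)%N /\ crowd_const lambda t n / (Ms n)%:R <= n.+1%:R^-1) ->
  hit lambda t n (Ms n) x mu @[n --> \oo] -->
  fine (P [set w | (walker_at xi mu t w < x%:E)%E]).
Proof.
move=> l0 walk t0 HM; case: mu => [x0| |] /=.
- have [_ [N [clk pathN]]] := walk x0.
  have -> : [set w | ((xi x0 t w)%:E < x%:E)%E] = [set w | xi x0 t w < x].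
    by apply/funext => w /=; rewrite lte_fin.
  under eq_cvg => n do
    (rewrite /hit -(run_ticks_law _ _ _ _ l0 clk t0); last by case: (HM n)).
  apply: (@prob_cvg _ _ _ P _ (fun n => crowded N t (Ms n) n)).
  + by move=> n; exact: (measurable_run_ticks (fun p => move p.1)
      (fun nu : \bar int => (nu < x%:E)%E) n (Ms n) x0%:E clk t0).
  + by move=> n; exact: (measurable_crowded clk t0).
  + exact: measurable_walker (walk x0) t0.
  + exact: crowded_cvg0 l0 clk t0 HM.
  have [_ clkae _ _] := clk.
  apply: filterS2 clkae pathN => w clkw pathw.
  near=> n => /sparse_crowded sp; have [M0 _] := HM n.
  rewrite /= (walk_run clkw pathw (grid0 t _) (fun j => grid_le _ j t0) sp).
  + by rewrite grid_last.
  + near: n; exists `|x0|%N => // n /=; lia.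
  + near: n; exists `|x|%N => // n /=; lia.
- have -> : [set w : T | (+oo < x%:E)%E] = set0 by apply/seteqP; split.
  rewrite measure0; under eq_cvg do rewrite /hit mean_fix//.
  exact: cvg_cst.
- have -> : [set w : T | (-oo < x%:E)%E] = setT.
    by apply/seteqP; split => // w _ /=; exact: ltNyr.
  rewrite probability_setT; under eq_cvg do rewrite /hit mean_fix//.
  by rewrite ltNyr; exact: cvg_cst.
Unshelve. all: by end_near. Qed.

(** * From finite systems to the process *)

Lemma fine_slots {R : realType} (lambda : int -> R) (t : R) : exists Ms : nat -> nat,
  forall n, (0 < Ms n)%N /\ crowd_const lambda t n / (Ms n)%:R <= n.+1%:R^-1.
Proof.
suff H n : exists M, (0 < M)%N /\ crowd_const lambda t n / M%:R <= n.+1%:R^-1.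
  by have [f fP] := choice H; exists f.
have c0 : 0 <= crowd_const lambda t n by rewrite /crowd_const mulr_ge0// sqr_ge0.
exists (Num.truncn (crowd_const lambda t n * n.+1%:R)).+1; split => //.
rewrite ler_pdivrMr ?ltr0n// mulrC ler_pdivlMr ?ltr0n//.
exact/ltW/truncnS_gt.
Qed.

Lemma run_pointwise {I : Type} {A S : Type} (act : I -> S -> S) (b : I -> bool)
    (l : seq I) (s : A -> S) (a : A) :
  run (fun p (s : A -> S) a => act p (s a)) b l s a = run act b l (s a).
Proof. by elim: l s => //= p l IH s; rewrite IH; case: (b p). Qed.

(** The event of the heights, looking only at the sites from [-L] on.  It depends on
    finitely many sites, hence passes to sitewise limits of configurations. *)
Definition sights {k : nat} (x m : 'I_k -> int) (L : nat) (c : config) : Prop :=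
  forall i, exists y : int, (- L%:Z <= y < x i) /\ ((m i)%:E <= c y)%E.

Lemma sights_eq {k : nat} (x m : 'I_k -> int) (L : nat) (c c' : config) :
  (forall i y, - L%:Z <= y < x i -> c y = c' y) ->
  sights x m L c -> sights x m L c'.
Proof.
move=> cc' H i; have [y [yLx my]] := H i; exists y; split => //.
by rewrite -(cc' i).
Qed.

Lemma near_sites {k : nat} (x : 'I_k -> int) (L : nat) (Q : int -> nat -> Prop) :
  (forall y, \forall n \near \oo, Q y n) ->
  \forall n \near \oo, forall i y, - L%:Z <= y < x i -> Q y n.
Proof.
move=> HQ.
have H : \forall n \near \oo, forall i : 'I_k, forall j : 'I_(`|x i| + L)%N,
    Q (j%:Z - L%:Z) n.
  by apply: filter_forall => i; apply: filter_forall => j; exact: HQ.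
apply: filterS H => n Hn i y yLx.
have jlt : (`|(y + L%:Z)%R| < `|x i| + L)%N by lia.
by have := Hn i (Ordinal jlt); have -> : (Ordinal jlt)%:Z - L%:Z = y by move=> /=; lia.
Qed.

Lemma measurable_ge {d} {T : measurableType d} (f : T -> \bar int) (m : int) :
  (forall v, measurable [set w | f w = v]) -> measurable [set w | (m%:E <= f w)%E].
Proof.
move=> mf; rewrite (_ : [set w | _] = [set w | f w = +oo%E] `|`
    [set w | exists v : int, m <= v /\ [set w | f w = v%:E] w]).
  apply: measurableU; [exact: mf|apply: measurable_exists => v].
  by apply: measurable_guard; exact: mf.
apply/seteqP; split => w /=; last by move=> [->|[v [mv ->]]]; rewrite ?leey ?lee_fin.
by case: (f w) => [v| |] //; rewrite ?lee_fin => mv; [right; exists v|left].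
Qed.

Lemma measurable_sights {d} {T : measurableType d} {k : nat} (x m : 'I_k -> int)
    (L : nat) (c : T -> config) :
  (forall y v, measurable [set w | c w y = v]) ->
  measurable [set w | sights x m L (c w)].
Proof.
move=> mc; rewrite (_ : [set w | _] = \bigcap_(i in [set: 'I_k])
  [set w | exists y : int, (- L%:Z <= y < x i) /\ [set w | ((m i)%:E <= c w y)%E] w]).
  apply: fin_bigcap_measurable => // i _; apply: measurable_exists => y.
  by apply: measurable_guard; apply: measurable_ge => v; exact: mc.
by apply/seteqP; split=> [w Hw i _|w Hw i]; [exact: Hw|exact: Hw i I].
Qed.

(** A particle to be tagged: the front itself, or, if the front is [-oo], a particle
    that is already to the left of [x]. *)
Lemma tagged_exists (c : config) (m x : int) : exists x0 : int,
  leftmost c m <> +oo%E ->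
  (m%:E <= c x0)%E /\ (leftmost c m = x0%:E \/ x0 < x).
Proof.
have := leftmost_front c m; case: (leftmost c m) => [u| |] H.
- by exists u => _; have [mu _] := front_fin H; split => //; left.
- by exists 0.
- have /H[y yx my] : (-oo < x%:E)%E by exact: ltNyr.
  by exists y => _; split => //; right.
Qed.

Lemma sights_front {k : nat} (x m : 'I_k -> int) (L : nat) (c : config)
    (b : int * nat -> bool) (l : seq (int * nat)) (i : 'I_k) :
  sights x m L (run (fun p => attempt p.1) b l c) ->
  (run (fun p => move p.1) b l (leftmost c (m i)) < (x i)%:E)%E.
Proof.
move=> /(_ i)[y [/andP[_ yx] my]].
have H : front (run (fun p => attempt p.1) b l c) (m i)
    (run (fun p => move p.1) b l (leftmost c (m i))).
  apply: (run_rel (Q := fun c mu => front c (m i) mu)); last exact: leftmost_front.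
  by move=> p c' mu; exact: attempt_front.
by apply/H; exists y.
Qed.

Lemma tagged_sighted (c : config) (m x x0 : int) (L : nat)
    (b : int * nat -> bool) (l : seq (int * nat)) :
  (leftmost c m <> +oo%E ->
    (m%:E <= c x0)%E /\ (leftmost c m = x0%:E \/ x0 < x)) ->
  (run (fun p => move p.1) b l (leftmost c m) < x%:E)%E ->
  ~~ (run (fun p => move p.1) b l x0%:E < (- L%:Z)%:E)%E ->
  exists y : int, (- L%:Z <= y < x) /\
    (m%:E <= run (fun p => attempt p.1) b l c y)%E.
Proof.
move=> mark runx; have ln : leftmost c m <> +oo%E.
  move=> lE; move: runx; rewrite lE.
  rewrite (run_inv (Q := fun mu => mu = +oo%E))//.
  by move=> p mu ->.
have [mx0 lx0] := mark ln.
have [y runy my] : exists2 y, run (fun p => move p.1) b l x0%:E = y%:E &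
    (m%:E <= run (fun p => attempt p.1) b l c y)%E.
  apply: (run_rel (Q := fun mu c => exists2 y, mu = y%:E & (m%:E <= c y)%E)).
    by move=> p mu c'; exact: attempt_track.
  by exists x0.
rewrite runy -leNgt lee_fin => Ly; exists y; split => //; rewrite Ly /=.
case: lx0 => [lE|x0x]; first by move: runx; rewrite lE runy lte_fin.
apply: le_lt_trans x0x; rewrite -lee_fin -runy.
apply: (run_inv (Q := fun mu => (mu <= x0%:E)%E)) => // p mu.
exact/le_trans/move_le.
Qed.

Section main.
Context {R : realType} {lambda : int -> R}.
Context (lambda_gt0 : forall x, 0 < lambda x).
Context {d : measure_display} {T : measurableType d} {P : probability T R}.
Context {eta0 : config} {eta : R -> T -> config}.
Context (eta_tasep : is_tasep P lambda eta0 eta).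
Context {d' : measure_display} {T' : measurableType d'} {P' : probability T' R}.
Context {xi : int -> R -> T' -> int}.
Context (xi_walker : forall x, is_walker P' lambda x (xi x)).
Context {t : R}.
Context (t_ge0 : 0 <= t).
Context {k : nat} {x m : 'I_k -> int}.
Context (x_le : forall i j : 'I_k, (i <= j)%N -> x i <= x j).
Context (m_le : forall i j : 'I_k, (i <= j)%N -> m i <= m j).

Let mu i := leftmost eta0 (m i).
Let q (mu : \bar int) (y : int) : R :=
  fine (P' [set w | (walker_at xi mu t w < y%:E)%E]).
Let G : 'M[R]_k := \matrix_(i, j) (q (mu i) (x j) - (i < j)%N%:R).

(** In the finite systems, [sights] implies that all fronts are below the [x i],
    which has probability [\det G] up to discretisation; conversely, if the fronts
    are below the [x i], the tagged particles realise [sights] unless one of their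
    walkers is below [-L].  Both inequalities pass to the limit. *)
Lemma sights_bounds (x0 : 'I_k -> int) (L : nat) :
  (forall i, mu i <> +oo%E -> ((m i)%:E <= eta0 (x0 i))%E /\
     (mu i = (x0 i)%:E \/ x0 i < x i)) ->
  let p := fine (P [set w | sights x m L (eta t w)]) in
  p <= \det G /\ \det G <= p + \sum_i q (x0 i)%:E (- L%:Z).
Proof.
move=> mark p.
have [mE [N [clk sample]]] := eta_tasep.
have [Ms HM] := fine_slots lambda t.
pose b n w := bits (fun z s => N z s w) (grid t (Ms n)).
pose C n w : config := run (fun p => attempt p.1) (b n w) (schedule n (Ms n)) eta0.
pose W n w nu := run (fun p => move p.1) (b n w) (schedule n (Ms n)) nu.
pose Sn n := [set w | `[< sights x m L (C n w) >] ].
pose En n := [set w | [forall i, (W n w (mu i) < (x i)%:E)%E] ].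
pose Fn n i := [set w | (W n w (x0 i)%:E < (- L%:Z)%:E)%E].
have mS n : measurable (Sn n).
  exact: (measurable_run_ticks (fun p => attempt p.1)
    (fun c => `[< sights x m L c >]) n (Ms n) eta0 clk t_ge0).
have mF n i : measurable (Fn n i).
  exact: (measurable_run_ticks (fun p => move p.1)
    (fun nu : \bar int => (nu < (- L%:Z)%:E)%E) n (Ms n) (x0 i)%:E clk t_ge0).
have EnE n : En n = [set w | [forall i, (run (fun p nu i => move p.1 (nu i))
    (b n w) (schedule n (Ms n)) mu i < (x i)%:E)%E]].
  apply/funext => w; congr is_true; apply: eq_forallb => i.
  by rewrite (run_pointwise (fun p => move p.1)).
have mEn n : measurable (En n).
  rewrite EnE; exact: (measurable_run_ticks (fun p nu i => move p.1 (nu i))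
    (fun nu : 'I_k -> \bar int => [forall i, (nu i < (x i)%:E)%E])
    n (Ms n) mu clk t_ge0).
pose Gn n : 'M[R]_k :=
  \matrix_(i, j) (hit lambda t n (Ms n) (x j) (mu i) - (i < j)%N%:R).
have PE n : fine (P (En n)) = \det (Gn n).
  rewrite EnE (run_ticks_law (fun p nu i => move p.1 (nu i))
    (fun nu : 'I_k -> \bar int => [forall i, (nu i < (x i)%:E)%E])
    _ _ lambda_gt0 clk t_ge0 (HM n).1).
  rewrite (mean_det _ (fun p => p.1))//.
  by move=> i j ij; apply/leftmost_homo/m_le.
have PF n i : fine (P (Fn n i)) = hit lambda t n (Ms n) (- L%:Z) (x0 i)%:E.
  exact: (run_ticks_law (fun p => move p.1)
    (fun nu : \bar int => (nu < (- L%:Z)%:E)%E) _ _ lambda_gt0 clk t_ge0 (HM n).1).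
have detG : \det (Gn n) @[n --> \oo] --> \det G.
  apply: cvg_det => i j; rewrite mxE; under eq_cvg do rewrite mxE.
  by apply: cvgB; [exact: hit_cvg|exact: cvg_cst].
have Scvg : fine (P (Sn n)) @[n --> \oo] --> p.
  apply: (@prob_cvg _ _ _ P _ (fun n => crowded N t (Ms n) n)) => //.
  - by move=> n; exact: (measurable_crowded clk t_ge0).
  - by apply: measurable_sights => y v; exact: mE.
  - exact: crowded_cvg0.
  have [_ clkae _ _] := clk.
  apply: filterS2 clkae sample => w clkw [_ [etan [pathn cvgn]]].
  have := near_sites x L (fun y => cvgn t y t_ge0).
  apply: filterS => n Hn /sparse_crowded sp.
  have CE : C n w = etan n t.
    have := tasep_run clkw (pathn n) (grid0 t _) (fun j => grid_le _ j t_ge0) sp.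
    by rewrite grid_last ?(HM n).1// => ->.
  rewrite /Sn /= CE; split => [/asboolP|H].
    by apply: sights_eq => i y /Hn.
  by apply/asboolP; apply: sights_eq H => i y /Hn.
have S_le n : fine (P (Sn n)) <= \det (Gn n).
  rewrite -PE -[leRHS]addr0 -(fine0 (R := R)) -(measure0 P).
  apply: fine_prob_le => //; apply: aeW => w /asboolP Sw; left.
  by apply/forallP => i; exact: (sights_front i Sw).
have le_S n : \det (Gn n) <=
    fine (P (Sn n)) + \sum_i hit lambda t n (Ms n) (- L%:Z) (x0 i)%:E.
  have mU : measurable (\big[setU/set0]_i Fn n i).
    by apply: bigsetU_measurable => i _.
  have PU : fine (P (\big[setU/set0]_i Fn n i)) <=
      \sum_i hit lambda t n (Ms n) (- L%:Z) (x0 i)%:E.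
    under [leRHS]eq_bigr do rewrite -PF.
    elim: (index_enum _) => [|i s IH]; first by rewrite !big_nil measure0.
    rewrite !big_cons; apply: le_trans (lerD (lexx _) IH).
    apply: fine_prob_le => //; first 2 last.
    - exact: aeW.
    - by apply: measurableU => //; apply: bigsetU_measurable.
    - by apply: bigsetU_measurable.
  apply: le_trans (lerD (lexx _) PU); rewrite -PE.
  apply: fine_prob_le => //; apply: aeW => w /forallP Ew.
  have [[i Fi]|nF] := pselect (exists i, Fn n i w).
    by right; rewrite -bigcup_seq; exists i; rewrite /= ?mem_index_enum.
  left; apply/asboolP => i; apply: tagged_sighted (mark i) (Ew i) _.
  by apply/negP => Fi; apply: nF; exists i.
split; first by apply: (ler_cvg_to Scvg detG); exact: nearW.
have sumcvg : (fine (P (Sn n)) + \sum_i hit lambda t n (Ms n) (- L%:Z) (x0 i)%:E)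
    @[n --> \oo] --> p + \sum_i q (x0 i)%:E (- L%:Z).
  apply: cvgD => //.
  apply: (@cvg_big R^o _ +%R 0 predT (@add_continuous _) _ \oo (index_enum 'I_k)
    (fun i n => hit lambda t n (Ms n) (- L%:Z) (x0 i)%:E)
    (fun i => q (x0 i)%:E (- L%:Z)) _) => i _.
  exact: hit_cvg.
by apply: (ler_cvg_to detG sumcvg); exact: nearW.
Qed.

(** The walker is at a finite site at time [t]. *)
Lemma escape_cvg0 (x0 : int) : q x0%:E (- L%:Z) @[L --> \oo] --> 0.
Proof.
apply: prob_vanish => [L|].
  rewrite (_ : [set w | _] = [set w | xi x0 t w < - L%:Z]).
    exact: measurable_walker (xi_walker x0) t_ge0.
  by apply/funext => w /=; rewrite lte_fin.
apply: aeW => w; exists `|xi x0 t w|%N => // L /=; rewrite lte_fin; lia.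
Qed.

Lemma measurable_heights :
  measurable [set w | forall i, ((m i)%:E <= height (eta t w) (x i))%E].
Proof.
have [mE _] := eta_tasep; rewrite (_ : [set w | _] = \bigcap_(i in [set: 'I_k])
    [set w | exists y : int, y < x i /\ [set w | ((m i)%:E <= eta t w y)%E] w]).
  apply: fin_bigcap_measurable => // i _; apply: measurable_exists => y.
  by apply: measurable_guard; apply: measurable_ge => v; exact: mE.
apply/seteqP; split => w /= H i => [_|].
  by have /height_geP[y yx my] := H i; exists y.
by apply/height_geP; have [y []] := H i I; exists y.
Qed.

Lemma sights_cvg :
  fine (P [set w | sights x m L (eta t w)]) @[L --> \oo] -->
  fine (P [set w | forall i, ((m i)%:E <= height (eta t w) (x i))%E]).
Proof.
have [mE _] := eta_tasep.
apply: (@prob_cvg _ _ _ P _ (fun=> set0)) => //.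
- by move=> L; apply: measurable_sights => y v; exact: mE.
- exact: measurable_heights.
- by rewrite measure0; exact: cvg_cst.
apply: aeW => w.
have [H|nH] := pselect (forall i, exists2 y, y < x i & ((m i)%:E <= eta t w y)%E).
  have {}H i : exists y, y < x i /\ ((m i)%:E <= eta t w y)%E.
    by have [y ? ?] := H i; exists y.
  have [y yP] := choice H.
  exists (\max_i `|y i|)%N => // L /= yL _; split => _ i.
    by apply/height_geP; have [yx my] := yP i; exists (y i).
  exists (y i); have [yx my] := yP i; split => //; rewrite yx andbT.
  by have := leq_trans (leq_bigmax (F := fun i => `|y i|%N) i) yL; lia.
apply: nearW => L _; split => H; case: nH => i.
  by have [y [/andP[_ yx] my]] := H i; exists y.
by apply/height_geP; exact: H.
Qed.

Lemma height_det :
  P [set w | forall i, ((m i)%:E <= height (eta t w) (x i))%E] = (\det G)%:E.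
Proof.
set E := [set w | _].
have [x0 mark] := choice (fun i => tagged_exists eta0 (m i) (x i)).
have Lcvg := sights_cvg.
have Gcst : (fun=> \det G) L @[L --> \oo] --> \det G by exact: cvg_cst.
have lo : fine (P E) <= \det G.
  apply: (ler_cvg_to Lcvg Gcst); apply: nearW => L.
  by have [] := sights_bounds L mark.
have hi : \det G <= fine (P E).
  have cvgS : (fine (P [set w | sights x m L (eta t w)]) +
      \sum_i q (x0 i)%:E (- L%:Z)) @[L --> \oo] --> fine (P E) + \sum_(i < k) 0.
    apply: cvgD => //.
    apply: (@cvg_big R^o _ +%R 0 predT (@add_continuous _) _ \oo (index_enum 'I_k)
      (fun i L => q (x0 i)%:E (- L%:Z)) (fun i => 0) _) => i _.
    exact: escape_cvg0.
  rewrite big1 ?addr0// in cvgS.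
  apply: (ler_cvg_to Gcst cvgS); apply: nearW => L.
  by have [] := sights_bounds L mark.
have <- : fine (P E) = \det G by lra.
rewrite fineK// fin_num_measure//; exact: measurable_heights.
Qed.

End main.

Theorem theorem1p1 (R : realType) (lambda : int -> R)
    (lambda_gt0 : forall x, 0 < lambda x)
    (d : measure_display) (T : measurableType d) (P : probability T R)
    (eta0 : config) (eta0_species : forall x, eta0 x != +oo%E)
    (eta : R -> T -> config) (eta_tasep : is_tasep P lambda eta0 eta)
    (d' : measure_display) (T' : measurableType d') (P' : probability T' R)
    (xi : int -> R -> T' -> int)
    (xi_walker : forall x, is_walker P' lambda x (xi x))
    (t : R) (t_ge0 : 0 <= t)
    (k : nat) (x m : 'I_k -> int)
    (x_incr : forall i j : 'I_k, (i < j)%N -> x i < x j)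
    (m_incr : forall i j : 'I_k, (i < j)%N -> m i < m j) :
  let mu i := leftmost eta0 (m i) in
  let G : 'M[R]_k := \matrix_(i, j)
    (fine (P' [set w | (walker_at xi (mu i) t w < (x j)%:E)%E]) - (i < j)%N%:R) in
  P [set w | forall i, ((m i)%:E <= height (eta t w) (x i))%E] = (\det G)%:E.
Proof.
move=> mu G; apply: (height_det lambda_gt0 eta_tasep xi_walker t_ge0) => i j.
  by rewrite leq_eqVlt => /orP[/eqP/val_inj ->//|/x_incr/ltW].
by rewrite leq_eqVlt => /orP[/eqP/val_inj ->//|/m_incr/ltW].
Qed.
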